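(* Let $R$ be a nonzero commutative unital ring. Let $\mathcal{M}_S$ be either $(f\mathcal{C})_S$ for a non-empty finite subset $S\subset\mathbb{N}$, or $(b\mathcal{C})_S$ for a finite subset $S\subset\mathbb{N}$ with $0\in S$, and let $r=\max S$. There is no left Bousfield localisation $\mathcal{M}_{\mathrm{new}}$ of $\mathcal{M}_S$ whose weak equivalences are the $(r+1)$-weak equivalences.
   Context: Conventions: $0\in\mathbb{N}$; all modules are over $R$. Filtered chain complexes. A filtered chain complex $A$ is a cohomologically graded chain complex of $R$-modules (differential $d$ of degree $+1$) with an increasing filtration by subcomplexes $F_pA\subseteq F_{p+1}A\subseteq A$, $p\in\mathbb{Z}$. Morphisms are chain maps $f$ with $f(F_pA)\subseteq F_pB$. The category is $f\mathcal{C}$. For $k\ge 0$ the $k$-cycles are $Z_k^{p,p+n}(A)=F_pA^n\cap d^{-1}F_{p-k}A^{n+1}$; the $k$-boundaries are $B_0^{p,p+n}(A)=F_{p-1}A^n$ and, for $k\ge1$, $B_k^{p,p+n}(A)=dZ_{k-1}^{p+k-1,p+k-1+n-1}(A)+Z_{k-1}^{p-1,p-1+n}(A)$; the $k$-page is $E_k^{p,p+n}(A)=Z_k^{p,p+n}(A)/B_k^{p,p+n}(A)$. For $k\ge0$, a morphism is a $k$-weak equivalence if it induces an isomorphism on $E_{k+1}^{p,p+n}$ for all $p,n\in\mathbb{Z}$. With $r=\max S$, $(f\mathcal{C})_S$ is the (known) cofibrantly generated model structure on $f\mathcal{C}$ whose weak equivalences are the $r$-weak equivalences and whose fibrations are the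 morphisms $f$ with $Z_s^{p,p+n}(f)$ surjective for all $p,n\in\mathbb{Z}$ and all $s\in S$. Bicomplexes. A bicomplex $A$ is a collection of $R$-modules $A^{i,j}$ ($i,j\in\mathbb{Z}$) with differentials $d_0\colon A^{i,j}\to A^{i,j+1}$, $d_1\colon A^{i,j}\to A^{i-1,j}$, $d_0d_0=0$, $d_1d_1=0$, $d_0d_1=d_1d_0$. The category is $b\mathcal{C}$. The product totalisation $\mathrm{Tot}^{\Pi}\colon b\mathcal{C}\to f\mathcal{C}$ is $\mathrm{Tot}^{\Pi}(A)^n=\prod_{i}A^{i,i+n}$, $F_p\mathrm{Tot}^{\Pi}(A)^n=\prod_{i\le p}A^{i,i+n}$, with differential $(a_i)_i\mapsto(d_0a_i+(-1)^nd_1a_{i+1})_i$. The spectral sequence of a bicomplex is that of $\mathrm{Tot}^{\Pi}(A)$, and a morphism of $b\mathcal{C}$ is a $k$-weak equivalence if it induces an isomorphism on $(k+1)$-pages. The $k$-witness cycles are $ZW_0^{p,p+n}(A)=A^{p,p+n}$ and, for $k\ge1$, $ZW_k^{p,p+n}(A)=\{(a_0,\dots,a_{k-1})\in\bigoplus_{j=0}^{k-1}A^{p-j,p+n-j}\mid d_0a_0=0,\ d_0a_j=d_1a_{j-1}\text{ for }j\ge1\}$. With $r=\max S$ and $0\in S$, $(b\mathcal{C})_S$ is the (known) cofibrantly generated model structure on $b\mathcal{C}$ whose weak equivalences are the $r$-weak equivalences and whose fibrations are the morphisms $f$ with $ZW_s^{p,p+n}(f)$ surjective for all $p,n$ and all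 $s\in S$. Left Bousfield localisation. For a class $\mathcal{K}$ of morphisms of a model category $\mathcal{M}$, an object $W$ is $\mathcal{K}$-local if it is fibrant and for all $f\colon A\to B$ in $\mathcal{K}$ the induced map of homotopy function complexes $\mathrm{map}(B,W)\to\mathrm{map}(A,W)$ is a weak equivalence of simplicial sets; $g\colon X\to Y$ is a $\mathcal{K}$-local equivalence if $\mathrm{map}(Y,W)\to\mathrm{map}(X,W)$ is a weak equivalence for all $\mathcal{K}$-local $W$. The left Bousfield localisation of $\mathcal{M}$ at $\mathcal{K}$, if it exists, is the model structure on the same category with weak equivalences the $\mathcal{K}$-local equivalences and with the same cofibrations as $\mathcal{M}$. *)

(* Defs.v *)
From HB Require Import structures.
From mathcomp Require Import all_boot all_order all_algebra.
From mathcomp Require Import finmap.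
From mathcomp Require Import boolp.

Set Implicit Arguments.
Unset Strict Implicit.
Unset Printing Implicit Defensive.

Import GRing.Theory.
Local Open Scope quotient_scope.
Local Open Scope ring_scope.

Record category := Category {
  obj :> Type;
  mor : obj -> obj -> Type;
  idm : forall A, mor A A;
  compm : forall A B C, mor B C -> mor A B -> mor A C;
  compm1 : forall A B (f : mor A B), compm f (idm A) = f;
  comp1m : forall A B (f : mor A B), compm (idm B) f = f;
  compmA : forall A B C D (h : mor C D) (g : mor B C) (f : mor A B),
    compm h (compm g f) = compm (compm h g) f }.

Arguments mor {c} A B.
Arguments idm {c} A.
Arguments compm {c A B C} g f.

Declare Scope cat_scope.
Delimit Scope cat_scope with cat.
Notation "g ∘ f" := (compm g f) (at level 40, left associativity) : cat_scope.
Local Open Scope cat_scope.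

Definition op (C : category) : category :=
  @Category C (fun A B => @mor C B A) (fun A => idm A)
    (fun A B D g f => compm f g) (fun A B f => comp1m f) (fun A B f => compm1 f)
    (fun A B D E h g f => esym (compmA f g h)).

Definition TypeCat : category :=
  @Category Type (fun S T => S -> T) (fun S x => x)
    (fun S T U g f x => g (f x)) (fun _ _ _ => erefl) (fun _ _ _ => erefl)
    (fun _ _ _ _ _ _ _ => erefl).

Record functor (C D : category) := Functor {
  fobj :> C -> D;
  fmap : forall A B, mor A B -> mor (fobj A) (fobj B);
  fmap1 : forall A, fmap (idm A) = idm (fobj A);
  fmapM : forall A B E (g : mor B E) (f : mor A B),
    fmap (g ∘ f) = fmap g ∘ fmap f }.

Arguments fmap {C D} F {A B} f : rename.

Record nat_trans (C D : category) (F G : functor C D) := NatTrans {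
  component :> forall A : C, mor (F A) (G A);
  naturality : forall (A B : C) (f : mor A B),
    component B ∘ fmap F f = fmap G f ∘ component A }.

Definition is_initial (C : category) (I : C) : Prop :=
  forall A : C, exists! f : mor I A, True.

Definition is_terminal (C : category) (T : C) : Prop :=
  forall A : C, exists! f : mor A T, True.

Record monotone_map (m n : nat) := MonotoneMap {
  mfun :> 'I_m.+1 -> 'I_n.+1;
  mfunP : {homo mfun : i j / (i <= j)%N} }.

Lemma monotone_mapP m n (f g : monotone_map m n) : f =1 g -> f = g.
Proof.
case: f g => [f fP] [g gP] /= /funext fg; subst g.
by congr MonotoneMap; apply: Prop_irrelevance.
Qed.

Definition monotone_id n : monotone_map n n :=
  @MonotoneMap n n id (fun i j ij => ij).

Definition monotone_comp m n p (g : monotone_map n p) (f : monotone_map m n) :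
    monotone_map m p :=
  @MonotoneMap m p (fun i => g (f i)) (fun i j ij => mfunP g (mfunP f ij)).

(* The object n : nat stands for the ordinal [n] = {0 < ... < n}. *)
Definition Delta : category.
Proof.
by refine (@Category nat monotone_map monotone_id monotone_comp _ _ _) => *;
  apply: monotone_mapP.
Defined.

Definition sset := functor (op Delta) TypeCat.
Definition sset_map (X Y : sset) := nat_trans X Y.

Definition sset_comp (X Y Z : sset) (g : sset_map Y Z) (f : sset_map X Y) :
  sset_map X Z.
Proof.
refine (@NatTrans _ _ X Z (fun n => component g n ∘ component f n) _).
by move=> m n u; rewrite -compmA naturality compmA naturality compmA.
Defined.

Definition simplex (n : nat) : sset.
Proof.
refine (@Functor (op Delta) TypeCat (fun m => @mor Delta m n)
          (fun m m' u v => compm (c := Delta) v u) _ _).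
- by move=> m; apply/funext => v; exact: (compm1 (c := Delta)).
- by move=> m m' m'' u v; apply/funext => w; exact: (compmA (c := Delta)).
Defined.

(* The horn Λ^n_k consists of the simplices of Δ^n missing a vertex other
   than k. *)
Definition in_horn n (k : 'I_n.+1) m (u : monotone_map m n) : Prop :=
  exists2 j, j != k & forall i, u i != j.

Definition horn n (k : 'I_n.+1) : sset.
Proof.
refine (@Functor (op Delta) TypeCat
  (fun m => {u : monotone_map m n | in_horn k u})
  (fun m m' u v => exist (@in_horn n k m') (monotone_comp (proj1_sig v) u) _) _ _).
- by move=> m; apply/funext => -[v vP]; apply/eq_exist/monotone_mapP.
- by move=> m m' m'' u v; apply/funext => -[w wP]; apply/eq_exist/monotone_mapP.
Unshelve.
by case: v => v [j jk vj]; exists j => // i; exact: vj.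
Defined.

Definition kan (K : sset) : Prop :=
  forall n (k : 'I_n.+2) (h : sset_map (horn k) K),
  exists g : sset_map (simplex n.+1) K,
    forall m (u : horn k m), component g m (proj1_sig u) = component h m u.

Definition sset_prod (X Y : sset) : sset.
Proof.
refine (@Functor (op Delta) TypeCat (fun n => (X n * Y n)%type)
  (fun m n u xy => (fmap X u xy.1, fmap Y u xy.2)) _ _).
- by move=> n; apply/funext => -[x y] /=; rewrite !fmap1.
- by move=> m n p u v; apply/funext => -[x y] /=; rewrite !fmapM.
Defined.

Definition const_monotone m n (i : 'I_n.+1) : monotone_map m n :=
  @MonotoneMap m n (fun _ => i) (fun _ _ _ => leqnn i).

(* When K is a Kan complex this is an equivalence relation on maps X -> K. *)
Definition shomotopic (X K : sset) (f g : sset_map X K) : Prop :=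
  exists H : sset_map (sset_prod X (simplex 1)) K,
    forall n (x : X n),
      component H n (x, const_monotone n ord0) = component f n x /\
      component H n (x, const_monotone n ord_max) = component g n x.

(* Weak homotopy equivalence: precomposition with f is a bijection
   [Y, K] -> [X, K] on simplicial homotopy classes for every Kan complex K. *)
Definition sset_weq (X Y : sset) (f : sset_map X Y) : Prop :=
  forall K : sset, kan K ->
    (forall g g' : sset_map Y K,
       shomotopic (sset_comp g f) (sset_comp g' f) -> shomotopic g g') /\
    (forall h : sset_map X K,
       exists g : sset_map Y K, shomotopic (sset_comp g f) h).

Definition mor_class (C : category) := forall A B : C, mor A B -> Prop.

Section ModelCategories.
Variable C : category.

Definition has_lift (A B X Y : C) (i : mor A B) (q : mor X Y) : Prop :=
  forall (u : mor A X) (v : mor B Y), q ∘ u = v ∘ i ->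
    exists2 h : mor B X, h ∘ i = u & q ∘ h = v.

Definition llp (P : mor_class C) : mor_class C :=
  fun A B i => forall (X Y : C) (q : mor X Y), P X Y q -> has_lift i q.

Definition mor_and (P Q : mor_class C) : mor_class C :=
  fun A B f => P A B f /\ Q A B f.

Definition retract_of (A B A' B' : C) (f : mor A B) (g : mor A' B') : Prop :=
  exists (i : mor A A') (j : mor B B') (s : mor A' A) (t : mor B' B),
    [/\ s ∘ i = idm A, t ∘ j = idm B, g ∘ i = j ∘ f & f ∘ s = t ∘ g].

Definition retract_closed (P : mor_class C) : Prop :=
  forall (A B A' B' : C) (f : mor A B) (g : mor A' B'),
    retract_of f g -> P A' B' g -> P A B f.

Definition two_of_three (P : mor_class C) : Prop :=
  forall (A B D : C) (f : mor A B) (g : mor B D),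
    [/\ P _ _ f -> P _ _ g -> P _ _ (g ∘ f),
        P _ _ f -> P _ _ (g ∘ f) -> P _ _ g
      & P _ _ g -> P _ _ (g ∘ f) -> P _ _ f].

Definition factors_as (P Q : mor_class C) : Prop :=
  forall (A B : C) (f : mor A B),
    exists (D : C) (i : mor A D) (q : mor D B), [/\ P _ _ i, Q _ _ q & q ∘ i = f].

Record model_data := ModelData {
  weq : mor_class C;
  cof : mor_class C;
  fib : mor_class C }.

Record is_model_structure (M : model_data) : Prop := {
  weq_two_of_three : two_of_three (weq M);
  weq_retract : retract_closed (weq M);
  cof_retract : retract_closed (cof M);
  fib_retract : retract_closed (fib M);
  cof_trivfib_lift : forall (A B X Y : C) (i : mor A B) (q : mor X Y),
    cof M i -> fib M q -> weq M q -> has_lift i q;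
  trivcof_fib_lift : forall (A B X Y : C) (i : mor A B) (q : mor X Y),
    cof M i -> weq M i -> fib M q -> has_lift i q;
  cof_trivfib_factor : factors_as (cof M) (mor_and (fib M) (weq M));
  trivcof_fib_factor : factors_as (mor_and (cof M) (weq M)) (fib M) }.

(* A model structure is determined by its weak equivalences and fibrations. *)
Definition model_of_weq_fib (W F : mor_class C) : model_data :=
  ModelData W (llp (mor_and F W)) F.

Definition cosimplicial := functor Delta C.

(* Cocones on the latching diagram of X at n: its objects are the injections
   [k] -> [n] with k < n, its morphisms the injections over [n]. *)
Definition latching_cocone (X : cosimplicial) (n : nat) (L : C)
    (leg : forall k (u : monotone_map k n), (k < n)%N -> injective u -> mor (X k) L) :
    Prop :=
  forall j k (v : monotone_map j k) (u : monotone_map k n) (jn : (j < n)%N)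
    (kn : (k < n)%N) (v_inj : injective v) (u_inj : injective u)
    (uv_inj : injective (monotone_comp u v)),
    leg k u kn u_inj ∘ fmap X v = leg j (monotone_comp u v) jn uv_inj.

Definition is_latching_object (X : cosimplicial) (n : nat) (L : C)
    (leg : forall k (u : monotone_map k n), (k < n)%N -> injective u -> mor (X k) L) :
    Prop :=
  latching_cocone leg /\
  forall (L' : C)
    (leg' : forall k (u : monotone_map k n), (k < n)%N -> injective u -> mor (X k) L'),
    latching_cocone leg' ->
    exists! h : mor L L', forall k u kn u_inj, h ∘ leg k u kn u_inj = leg' k u kn u_inj.

Definition reedy_cofibrant (M : model_data) (X : cosimplicial) : Prop :=
  forall n, exists (L : C)
    (leg : forall k (u : monotone_map k n), (k < n)%N -> injective u -> mor (X k) L)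
    (l : mor L (X n)),
    [/\ is_latching_object leg,
        forall k (u : monotone_map k n) kn u_inj, l ∘ leg k u kn u_inj = fmap X u
      & cof M l].

(* X is a cosimplicial resolution of A, with augmentation a : X -> cc_* A. *)
Definition cosimplicial_resolution (M : model_data) (A : C) (X : cosimplicial)
    (a : forall n, mor (X n) A) : Prop :=
  [/\ forall m n (u : monotone_map m n), a n ∘ fmap X u = a m,
      forall n, weq M (a n)
    & reedy_cofibrant M X].

Definition mapping_sset (X : cosimplicial) (W : C) : sset.
Proof.
refine (@Functor (op Delta) TypeCat (fun n => mor (X n) W)
          (fun m n u f => f ∘ fmap X u) _ _).
- by move=> n; apply/funext => f; rewrite [fmap X _](fmap1 X n) compm1.
- move=> m n p u v; apply/funext => f.
  by rewrite /= [fmap X _](fmapM X) compmA.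
Defined.

Definition mapping_sset_map (X Y : cosimplicial) (F : nat_trans X Y) (W : C) :
  sset_map (mapping_sset Y W) (mapping_sset X W).
Proof.
refine (@NatTrans (op Delta) TypeCat (mapping_sset Y W) (mapping_sset X W)
          (fun n f => f ∘ component F n) _).
by move=> m n u; apply/funext => f; rewrite /= -!compmA -naturality.
Defined.

(* map(B, W) -> map(A, W) is a weak equivalence, where W is fibrant and
   map(A, W) = C(Ã, W) for a cosimplicial resolution Ã of A.  The property does
   not depend on the resolution of f, and a resolution always exists. *)
Definition map_into_weq (M : model_data) (A B : C) (f : mor A B) (W : C) : Prop :=
  exists (X Y : cosimplicial) (a : forall n, mor (X n) A) (b : forall n, mor (Y n) B)
    (F : nat_trans X Y),
    [/\ cosimplicial_resolution M a, cosimplicial_resolution M b,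
        forall n, b n ∘ component F n = f ∘ a n
      & sset_weq (mapping_sset_map F W)].

Definition fibrant (M : model_data) (W : C) : Prop :=
  exists (T : C) (t : mor W T), is_terminal T /\ fib M t.

Definition local_object (M : model_data) (K : mor_class C) (W : C) : Prop :=
  fibrant M W /\ forall (A B : C) (f : mor A B), K A B f -> map_into_weq M f W.

Definition local_equivalence (M : model_data) (K : mor_class C) : mor_class C :=
  fun X Y g => forall W : C, local_object M K W -> map_into_weq M g W.

Definition left_Bousfield_localisation (M : model_data) (K : mor_class C)
    (N : model_data) : Prop :=
  [/\ is_model_structure N,
      forall (A B : C) (f : mor A B), weq N f <-> local_equivalence M K f
    & forall (A B : C) (f : mor A B), cof N f <-> cof M f].

End ModelCategories.

Section QuotientModule.
Variables (R : comNzRingType) (V : lmodType R) (U : submodClosed V).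

Definition submod_pred : {pred V} := fun x => x \in U.

Lemma submod_pred_zmod : zmod_closed submod_pred.
Proof.
split=> [|x y xU yU]; first exact: rpred0.
by rewrite -scaleN1r; apply: (rpredD xU); apply: rpredZ.
Qed.

HB.instance Definition _ := GRing.isZmodClosed.Build V submod_pred submod_pred_zmod.

Definition quotmod : Type := Quotient.quot submod_pred.
HB.instance Definition _ := GRing.Zmodule.on quotmod.

Definition quotmod_pi (x : V) : quotmod := \pi_(Quotient.quot submod_pred) x.

Lemma quotmod_piP x y : quotmod_pi x = quotmod_pi y <-> x - y \in U.
Proof.
have -> : (x - y \in U) = (x - y \in submod_pred) by [].
rewrite Quotient.idealrBE; split; first by move=> e; apply/eqP.
by move=> /eqP.
Qed.

Lemma quotmod_reprK (x : quotmod) : quotmod_pi (repr x) = x.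
Proof. exact: reprK. Qed.

Lemma quotmod_piD : {morph quotmod_pi : x y / x + y}.
Proof. by move=> x y; rewrite /quotmod_pi raddfD. Qed.

Definition quotmod_scale (a : R) (x : quotmod) : quotmod :=
  quotmod_pi (a *: repr x).

Lemma quotmod_scaleE a x : quotmod_scale a (quotmod_pi x) = quotmod_pi (a *: x).
Proof.
apply/quotmod_piP; rewrite -scalerBr; apply: rpredZ; apply/quotmod_piP.
exact: quotmod_reprK.
Qed.

Lemma quotmod_scaleA a b x :
  quotmod_scale a (quotmod_scale b x) = quotmod_scale (a * b) x.
Proof. by rewrite -[x]quotmod_reprK !quotmod_scaleE scalerA. Qed.

Lemma quotmod_scale1 : left_id 1 quotmod_scale.
Proof. by move=> x; rewrite -[x]quotmod_reprK quotmod_scaleE scale1r. Qed.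

Lemma quotmod_scaleDr : right_distributive quotmod_scale +%R.
Proof.
move=> a x y; rewrite -[x]quotmod_reprK -[y]quotmod_reprK.
by rewrite -quotmod_piD !quotmod_scaleE scalerDr quotmod_piD.
Qed.

Lemma quotmod_scaleDl x : {morph quotmod_scale^~ x : a b / a + b}.
Proof.
by move=> a b; rewrite -[x]quotmod_reprK !quotmod_scaleE scalerDl quotmod_piD.
Qed.

HB.instance Definition _ := GRing.Zmodule_isLmodule.Build R quotmod
  quotmod_scaleA quotmod_scale1 quotmod_scaleDr quotmod_scaleDl.

Lemma quotmod_pi_linear : linear quotmod_pi.
Proof. by move=> a x y; rewrite quotmod_piD -quotmod_scaleE. Qed.

HB.instance Definition _ :=
  GRing.isLinear.Build R V quotmod *:%R quotmod_pi quotmod_pi_linear.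

End QuotientModule.

Section ProductModule.
Variables (R : comNzRingType) (I : Type) (V : I -> lmodType R).

Definition prodmod : Type := forall i, V i.
HB.instance Definition _ := Choice.on prodmod.

Fact prodmod_addA : associative (fun x y : prodmod => (fun i => x i + y i) : prodmod).
Proof. by move=> x y z; apply: functional_extensionality_dep => i; rewrite addrA. Qed.
Fact prodmod_addC : commutative (fun x y : prodmod => (fun i => x i + y i) : prodmod).
Proof. by move=> x y; apply: functional_extensionality_dep => i; rewrite addrC. Qed.
Fact prodmod_add0 : left_id ((fun=> 0) : prodmod)
  (fun x y : prodmod => (fun i => x i + y i) : prodmod).
Proof. by move=> x; apply: functional_extensionality_dep => i; rewrite add0r. Qed.
Fact prodmod_addN : left_inverse ((fun=> 0) : prodmod) (fun x i => - x i)
  (fun x y : prodmod => (fun i => x i + y i) : prodmod).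
Proof. by move=> x; apply: functional_extensionality_dep => i; rewrite addNr. Qed.

HB.instance Definition _ := GRing.isZmodule.Build prodmod
  prodmod_addA prodmod_addC prodmod_add0 prodmod_addN.

Definition prodmod_scale (a : R) (x : prodmod) : prodmod := fun i => a *: x i.

Fact prodmod_scaleA a b x :
  prodmod_scale a (prodmod_scale b x) = prodmod_scale (a * b) x.
Proof. by apply: functional_extensionality_dep => i; exact: scalerA. Qed.
Fact prodmod_scale1 : left_id 1 prodmod_scale.
Proof. by move=> x; apply: functional_extensionality_dep => i; exact: scale1r. Qed.
Fact prodmod_scaleDr : right_distributive prodmod_scale +%R.
Proof. by move=> a x y; apply: functional_extensionality_dep => i; exact: scalerDr. Qed.
Fact prodmod_scaleDl x : {morph prodmod_scale^~ x : a b / a + b}.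
Proof. by move=> a b; apply: functional_extensionality_dep => i; exact: scalerDl. Qed.

HB.instance Definition _ := GRing.Zmodule_isLmodule.Build R prodmod
  prodmod_scaleA prodmod_scale1 prodmod_scaleDr prodmod_scaleDl.

End ProductModule.

Lemma eq_linear (R : comNzRingType) (U V : lmodType R) (f g : {linear U -> V}) :
  f =1 g -> f = g.
Proof.
case: f g => [f cf] [g cg] /= /funext fg; subst g.
case: cf cg => [[mf] [sf]] [[mg] [sg]].
by rewrite (Prop_irrelevance mf mg) (Prop_irrelevance sf sg).
Qed.

(* Differentials are indexed by proofs of n + 1 = m (unique, since int has
   decidable equality); this avoids transports between A^{(n-1)+1} and A^n. *)
Record fcomplex (R : comNzRingType) := FComplex {
  fc_mod :> int -> lmodType R;
  fc_d : forall n m : int, n + 1 = m -> {linear fc_mod n -> fc_mod m};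
  fc_dd : forall n m l (e : n + 1 = m) (e' : m + 1 = l) x,
    fc_d e' (fc_d e x) = 0;
  fc_F : forall p n : int, submodClosed (fc_mod n);
  fc_FS : forall p n x, x \in fc_F p n -> x \in fc_F (p + 1) n;
  fc_Fd : forall p n m (e : n + 1 = m) x,
    x \in fc_F p n -> fc_d e x \in fc_F p m }.

Record fhom (R : comNzRingType) (A B : fcomplex R) := FHom {
  fhom_fun :> forall n, {linear A n -> B n};
  fhom_d : forall n m (e : n + 1 = m) x,
    fhom_fun m (fc_d A e x) = fc_d B e (fhom_fun n x);
  fhom_F : forall p n x, x \in fc_F A p n -> fhom_fun n x \in fc_F B p n }.

Section FilteredComplexes.
Variable R : comNzRingType.

Lemma fhomP (A B : fcomplex R) (f g : fhom A B) : (forall n, f n =1 g n) -> f = g.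
Proof.
case: f g => [f fd fF] [g gd gF] /= fg.
have e : f = g by apply: functional_extensionality_dep => n; exact: (eq_linear (fg n)).
by subst g; congr FHom.
Qed.

Definition fhom_id (A : fcomplex R) : fhom A A :=
  @FHom R A A (fun n => idfun) (fun _ _ _ _ => erefl) (fun _ _ _ xF => xF).

Definition fhom_comp (A B D : fcomplex R) (g : fhom B D) (f : fhom A B) : fhom A D.
Proof.
refine (@FHom R A D (fun n => g n \o f n) _ _).
- by move=> n m e x /=; rewrite !fhom_d.
- by move=> p n x xF /=; do 2 apply: fhom_F.
Defined.

Definition fC : category.
Proof.
by refine (@Category (fcomplex R) (@fhom R) fhom_id fhom_comp _ _ _) => *; apply: fhomP => ? ?.
Defined.

(* Zcyc k p n A is Z_k^{p,p+n}(A), a submodule of A^n. *)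
Definition Zcyc (k : nat) (p n : int) (A : fcomplex R) : {pred A n} :=
  [pred x | (x \in fc_F A p n) &&
            (fc_d A (erefl (n + 1)) x \in fc_F A (p - k%:Z) (n + 1))].

Arguments Zcyc : clear implicits.

Lemma Zcyc_submod k p n A : submod_closed (Zcyc k p n A).
Proof.
split=> [|a x y]; first by rewrite !inE !linear0 !rpred0.
move=> /andP[xF dxF] /andP[yF dyF]; rewrite inE linearP.
by apply/andP; split; apply: rpredD => //; apply: rpredZ.
Qed.

HB.instance Definition _ k p n (A : fcomplex R) :=
  GRing.isSubmodClosed.Build R (A n) (Zcyc k p n A) (Zcyc_submod k p n A).

(* Bbnd k p n A is B_k^{p,p+n}(A); in the second clause k stands for k-1. *)
Definition Bbnd (k : nat) (p n : int) (A : fcomplex R) : {pred A n} :=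
  if k is k.+1 then
    [pred x | `[< exists y z,
       [/\ y \in Zcyc k (p + k%:Z) (n - 1) A, z \in Zcyc k (p - 1) n A
         & x = fc_d A (subrK 1 n) y + z] >]]
  else [pred x | x \in fc_F A (p - 1) n].

Arguments Bbnd : clear implicits.

Lemma Bbnd_submod k p n A : submod_closed (Bbnd k p n A).
Proof.
case: k => [|k]; first by split=> [|a x y xF yF]; rewrite inE ?rpred0 ?rpredD ?rpredZ.
split=> [|a _ _ /asboolP[y [z [yZ zZ ->]]] /asboolP[y' [z' [yZ' zZ' ->]]]].
  by apply/asboolP; exists 0, 0; split; rewrite ?rpred0 // linear0 addr0.
apply/asboolP; exists (a *: y + y'), (a *: z + z'); split.
- by rewrite rpredD ?rpredZ.
- by rewrite rpredD ?rpredZ.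
- by rewrite linearP scalerDr addrACA.
Qed.

Record cycle (k : nat) (p n : int) (A : fcomplex R) := Cycle {
  cycle_val : A n;
  cycle_valP : cycle_val \in Zcyc k p n A }.

HB.instance Definition _ k p n (A : fcomplex R) := [isSub for @cycle_val k p n A].
HB.instance Definition _ k p n (A : fcomplex R) := [Choice of cycle k p n A by <:].
HB.instance Definition _ k p n (A : fcomplex R) := [SubChoice_isSubZmodule of cycle k p n A by <:].
HB.instance Definition _ k p n (A : fcomplex R) := [SubZmodule_isSubLmodule of cycle k p n A by <:].

(* B_k viewed inside Z_k. *)
Definition boundary (k : nat) (p n : int) (A : fcomplex R) : {pred cycle k p n A} :=
  [pred x | val x \in Bbnd k p n A].

Arguments boundary : clear implicits.

Lemma boundary_submod k p n A : submod_closed (boundary k p n A).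
Proof.
have [B0 BP] := Bbnd_submod k p n A.
split=> [|a x y xB yB]; first by rewrite inE raddf0.
by rewrite inE linearP; exact: BP.
Qed.

HB.instance Definition _ k p n (A : fcomplex R) :=
  GRing.isSubmodClosed.Build R (cycle k p n A) (boundary k p n A)
    (boundary_submod k p n A).

(* page k p n A is E_k^{p,p+n}(A). *)
Definition page (k : nat) (p n : int) (A : fcomplex R) : lmodType R :=
  quotmod (boundary k p n A).

Section PageMap.
Variables (k : nat) (p n : int) (A B : fcomplex R) (f : fhom A B).

Lemma fhom_Zcyc i q m x : x \in Zcyc i q m A -> f m x \in Zcyc i q m B.
Proof. by move=> /andP[xF dxF]; rewrite !inE -fhom_d !fhom_F. Qed.

Lemma fhom_Bbnd x : x \in Bbnd k p n A -> f n x \in Bbnd k p n B.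
Proof.
case: k => [|i] /=; first exact: fhom_F.
move=> /asboolP[y [z [yZ zZ ->]]]; apply/asboolP.
by exists (f _ y), (f _ z); rewrite !fhom_Zcyc // linearD fhom_d.
Qed.

Definition cycle_map (x : cycle k p n A) : cycle k p n B :=
  Cycle (fhom_Zcyc (cycle_valP x)).

Definition page_map (x : page k p n A) : page k p n B :=
  quotmod_pi (boundary k p n B) (cycle_map (repr x)).

Lemma page_mapE x :
  page_map (quotmod_pi (boundary k p n A) x) = quotmod_pi (boundary k p n B) (cycle_map x).
Proof.
apply/quotmod_piP; rewrite inE raddfB /=.
have /quotmod_piP := quotmod_reprK (quotmod_pi (boundary k p n A) x).
by rewrite inE raddfB /= => /fhom_Bbnd; rewrite raddfB.
Qed.

Lemma page_map_linear : linear page_map.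
Proof.
move=> a x y; rewrite -[x]quotmod_reprK -[y]quotmod_reprK.
rewrite -linearP !page_mapE -linearP; congr quotmod_pi.
by apply: val_inj; rewrite linearP /= !linearP.
Qed.

HB.instance Definition _ :=
  GRing.isLinear.Build R (page k p n A) (page k p n B) *:%R page_map page_map_linear.

End PageMap.

(* The induced map on the (k+1)-page is linear, so it is an isomorphism if
   and only if it is bijective. *)
Definition fC_weq (k : nat) : mor_class fC :=
  fun A B f => forall p n, bijective (@page_map k.+1 p n A B f).

Definition fC_fib (S : {fset nat}) : mor_class fC :=
  fun A B (f : fhom A B) => forall s, s \in S -> forall (p n : int) (y : cycle s p n B),
    exists x : cycle s p n A, cycle_map f x = y.

Definition fC_model (S : {fset nat}) : model_data fC :=
  model_of_weq_fib (fC_weq (\max_(s <- S) s)%N) (fC_fib S).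

End FilteredComplexes.

Arguments Zcyc {R} k p n A.
Arguments Bbnd {R} k p n A.
Arguments boundary {R} k p n A.

(* A bidegree s = (i, j) is a pair of integers; d_0 has bidegree (0, 1) and
   d_1 has bidegree (-1, 0).  As above, differentials are indexed by proofs of
   equations between bidegrees. *)
Definition bideg : Type := (int * int)%type.
HB.instance Definition _ := GRing.Zmodule.on bideg.

Definition deg0 : bideg := (0, 1).
Definition deg1 : bideg := (- 1, 0).

Record bicomplex (R : comNzRingType) := Bicomplex {
  bc_mod :> bideg -> lmodType R;
  bc_d0 : forall s t, s + deg0 = t -> {linear bc_mod s -> bc_mod t};
  bc_d1 : forall s t, s + deg1 = t -> {linear bc_mod s -> bc_mod t};
  bc_d0d0 : forall s t u (e : s + deg0 = t) (e' : t + deg0 = u) x,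
    bc_d0 e' (bc_d0 e x) = 0;
  bc_d1d1 : forall s t u (e : s + deg1 = t) (e' : t + deg1 = u) x,
    bc_d1 e' (bc_d1 e x) = 0;
  bc_d0d1 : forall s t t' u (e1 : s + deg1 = t) (e0 : t + deg0 = u)
      (e0' : s + deg0 = t') (e1' : t' + deg1 = u) x,
    bc_d0 e0 (bc_d1 e1 x) = bc_d1 e1' (bc_d0 e0' x) }.

Record bhom (R : comNzRingType) (A B : bicomplex R) := BHom {
  bhom_fun :> forall s, {linear A s -> B s};
  bhom_d0 : forall s t (e : s + deg0 = t) x,
    bhom_fun t (bc_d0 A e x) = bc_d0 B e (bhom_fun s x);
  bhom_d1 : forall s t (e : s + deg1 = t) x,
    bhom_fun t (bc_d1 A e x) = bc_d1 B e (bhom_fun s x) }.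

Section Bicomplexes.
Variable R : comNzRingType.

Lemma bhomP (A B : bicomplex R) (f g : bhom A B) : (forall s, f s =1 g s) -> f = g.
Proof.
case: f g => [f f0 f1] [g g0 g1] /= fg.
have e : f = g by apply: functional_extensionality_dep => n; exact: (eq_linear (fg n)).
by subst g; congr BHom.
Qed.

Definition bhom_id (A : bicomplex R) : bhom A A :=
  @BHom R A A (fun s => idfun) (fun _ _ _ _ => erefl) (fun _ _ _ _ => erefl).

Definition bhom_comp (A B D : bicomplex R) (g : bhom B D) (f : bhom A B) : bhom A D.
Proof.
refine (@BHom R A D (fun s => g s \o f s) _ _).
- by move=> s t e x /=; rewrite !bhom_d0.
- by move=> s t e x /=; rewrite !bhom_d1.
Defined.

Definition bC : category.
Proof.
by refine (@Category (bicomplex R) (@bhom R) bhom_id bhom_comp _ _ _) => *; apply: bhomP => ? ?.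
Defined.

Section Totalisation.
Variable A : bicomplex R.

Definition tot_mod (n : int) : lmodType R :=
  prodmod (fun i : int => A (i, i + n)).

Lemma tot_deg0 (i n m : int) : n + 1 = m -> (i, i + n) + deg0 = (i, i + m).
Proof. by move=> <-; congr pair; rewrite /= ?addr0 ?addrA. Qed.

Lemma tot_deg1 (i n m : int) :
  n + 1 = m -> (i + 1, i + 1 + n) + deg1 = (i, i + m).
Proof. by move=> <-; congr pair; rewrite /= ?addr0 ?addrK // -addrA (addrC 1). Qed.

(* The sign (-1)^n, n an integer, only depends on the parity of |n|. *)
Definition tot_d (n m : int) (e : n + 1 = m) (a : tot_mod n) : tot_mod m :=
  fun i => bc_d0 A (tot_deg0 i e) (a i)
           + (- 1) ^+ `|n|%N *: bc_d1 A (tot_deg1 i e) (a (i + 1)).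

Lemma tot_d_linear (n m : int) (e : n + 1 = m) : linear (tot_d e).
Proof.
move=> c a b; apply: functional_extensionality_dep => i; rewrite /tot_d.
have E (V : int -> lmodType R) (x y : prodmod V) j :
  (c *: x + y : prodmod V) j = c *: x j + y j by [].
by rewrite !E !linearP !scalerDr /= addrACA.
Qed.

HB.instance Definition _ (n m : int) (e : n + 1 = m) :=
  GRing.isLinear.Build R (tot_mod n) (tot_mod m) *:%R (tot_d e) (tot_d_linear e).

Lemma signr_absS (n m : int) : n + 1 = m ->
  (- 1) ^+ `|m|%N = - ((- 1) ^+ `|n|%N) :> R.
Proof.
case: n => n <-.
  have -> : n%:Z + 1 = n.+1%:Z by rewrite -addn1 PoszD.
  by rewrite !absz_nat exprS mulN1r.
have -> : Negz n + 1 = - n%:Z by rewrite NegzE -addn1 PoszD opprD addrNK.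
by rewrite abszN NegzE abszN !absz_nat exprS mulN1r opprK.
Qed.

Lemma tot_dd (n m l : int) (e : n + 1 = m) (e' : m + 1 = l) x : tot_d e' (tot_d e x) = 0.
Proof.
apply: functional_extensionality_dep => i; rewrite /tot_d.
rewrite !linearD !linearZ /= bc_d0d0 bc_d1d1 (signr_absS e) scaleNr !scaler0.
rewrite add0r addr0 (bc_d0d1 (tot_deg1 i e) (tot_deg0 i e') (tot_deg0 (i + 1) e)
  (tot_deg1 i e')).
exact: subrr.
Qed.

Definition tot_F (p n : int) : {pred tot_mod n} :=
  [pred a | `[< forall i, p < i -> a i = 0 >]].

Arguments tot_F : clear implicits.

Lemma tot_F_submod p n : submod_closed (tot_F p n).
Proof.
split=> [|c a b /asboolP aF /asboolP bF]; apply/asboolP => // i pi.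
rewrite (_ : (c *: a + b : tot_mod n) i = c *: a i + b i) //.
by rewrite aF // bF // scaler0 addr0.
Qed.

HB.instance Definition _ p n :=
  GRing.isSubmodClosed.Build R (tot_mod n) (tot_F p n) (tot_F_submod p n).

Lemma tot_FS p n x : x \in tot_F p n -> x \in tot_F (p + 1) n.
Proof.
move=> /asboolP xF; apply/asboolP => i pi; apply: xF.
by rewrite (Order.POrderTheory.lt_trans _ pi) // Num.Theory.ltrDl.
Qed.

Lemma tot_Fd (p n m : int) (e : n + 1 = m) x : x \in tot_F p n -> tot_d e x \in tot_F p m.
Proof.
move=> /asboolP xF; apply/asboolP => i pi; rewrite /tot_d xF // xF; last first.
  by rewrite (Order.POrderTheory.lt_trans pi) // Num.Theory.ltrDl.
by rewrite !linear0 addr0.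
Qed.

Definition Tot : fcomplex R :=
  @FComplex R tot_mod (fun n m e => tot_d e) tot_dd (fun p n => tot_F p n)
    tot_FS tot_Fd.

End Totalisation.

Arguments tot_F A p n : clear implicits.

Section TotalisationMap.
Variables (A B : bicomplex R) (f : bhom A B).

Definition tot_map n (a : tot_mod A n) : tot_mod B n := fun i => f (i, i + n) (a i).

Lemma tot_map_linear n : linear (@tot_map n).
Proof.
move=> c a b; apply: functional_extensionality_dep => i.
exact: (linearP (f (i, i + n))).
Qed.

HB.instance Definition _ n :=
  GRing.isLinear.Build R (tot_mod A n) (tot_mod B n) *:%R (@tot_map n)
    (@tot_map_linear n).

Lemma tot_map_d (n m : int) (e : n + 1 = m) x : tot_map (tot_d e x) = tot_d e (tot_map x).
Proof.
apply: functional_extensionality_dep => i; rewrite /tot_map /tot_d.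
by rewrite linearD linearZ /= bhom_d0 bhom_d1.
Qed.

Lemma tot_map_F p n x : x \in tot_F A p n -> tot_map x \in tot_F B p n.
Proof.
move=> /asboolP xF; apply/asboolP => i pi.
by rewrite /tot_map xF // linear0.
Qed.

Definition Tot_map : fhom (Tot A) (Tot B) :=
  @FHom R (Tot A) (Tot B) (fun n => @tot_map n) tot_map_d tot_map_F.

End TotalisationMap.

(* Underlying families of ZW_k^{p,p+n}(A): a_j lies in A^{p-j,p+n-j}. *)
Definition witness_family (k : nat) (p n : int) (A : bicomplex R) : Type :=
  if k is k'.+1 then
    forall j : 'I_k'.+1, A (p - j%:Z, p + n - j%:Z)
  else A (p, p + n).

(* In the last condition t = (p - j, p + n - j + 1), where j = i + 1, is the
   common target of d_0 on a_j and of d_1 on a_{j-1} = a_i. *)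
Definition is_witness_cycle (k : nat) (p n : int) (A : bicomplex R) :
    witness_family k p n A -> Prop :=
  match k with
  | 0 => fun _ => True
  | k'.+1 => fun a : forall j : 'I_k'.+1, A (p - j%:Z, p + n - j%:Z) =>
      bc_d0 A erefl (a ord0) = 0 /\
      forall (i j : 'I_k'.+1), j = i.+1 :> nat ->
        forall t (e0 : (p - j%:Z, p + n - j%:Z) + deg0 = t)
                 (e1 : (p - i%:Z, p + n - i%:Z) + deg1 = t),
          bc_d0 A e0 (a j) = bc_d1 A e1 (a i)
  end.

Definition witness_map (k : nat) (p n : int) (A B : bicomplex R) (f : bhom A B) :
    witness_family k p n A -> witness_family k p n B :=
  match k with
  | 0 => fun a => f (p, p + n) a
  | k'.+1 => fun (a : forall j : 'I_k'.+1, A (p - j%:Z, p + n - j%:Z)) j => f _ (a j)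
  end.

Definition bC_weq (k : nat) : mor_class bC :=
  fun A B f => fC_weq k (Tot_map f : @mor (fC R) (Tot A) (Tot B)).

Definition bC_fib (S : {fset nat}) : mor_class bC :=
  fun A B f => forall s, s \in S -> forall (p n : int) (b : witness_family s p n B),
    is_witness_cycle b ->
    exists2 a : witness_family s p n A, is_witness_cycle a & witness_map f a = b.

Definition bC_model (S : {fset nat}) : model_data bC :=
  model_of_weq_fib (bC_weq (\max_(s <- S) s)%N) (bC_fib S).

End Bicomplexes.

Arguments tot_F {R} A p n.

(* Main.v *)
Require Import Defs.
From HB Require Import structures.
From mathcomp Require Import all_boot all_order all_algebra.
From mathcomp Require Import finmap.
From mathcomp Require Import boolp zify.

(** Why no such localisation exists.

    Two properties of the new model structure conflict: its weak equivalences
    are the (r+1)-weak equivalences, and every morphism lifting against the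
    trivial fibrations of the old structure is one of its cofibrations.

    For filtered complexes, let the sphere be the filtered complex that
    corepresents (r+1)-cycles of filtration 0 and the disc the one that
    corepresents pairs (x, y) of r-cycles of filtrations r and -1.  The inclusion
    sending the universal cycle to dx + y lifts against every f that is
    surjective on r-cycles and an isomorphism on the page E_(r+1)
    ([sphere_incl_lift]), so it is a cofibration.  Both ends have E_(r+2) = 0, so
    it is an (r+1)-weak equivalence.  In the new structure it is therefore a
    trivial cofibration, and an (r+1)-cycle of filtration 0 of a fibrant object X
    must be of the form dx + y.  If the cycle is closed, this makes it zero in
    E_(r+2).  Take for X a fibrant replacement of the complex R concentrated in
    filtration 0 with zero differential: the class of 1 survives in its page
    E_(r+2), which is a contradiction ([cofibrations_and_weqs_incompatible]).

    The argument is carried out for a category over filtered complexes through a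
    functor T with enough universal arrows C -> T L that are isomorphisms on
    E_(r+2).  For filtered complexes T is the identity.  For bicomplexes T is
    the product totalisation; the universal arrow out of C has as target the
    totalisation of

      L^(i,i+n) = C^n / F_(i-1) x C^(n-1) / F_i,

    where a class c in C^n has its i-th component [c]_i in the first factor and
    d_1 [c]_(i+1) lies in the second.  The column of index i is the mapping cone
    of C / F_(i-1) -> C / F_i, so Tot L has the pages of C from E_1 on
    ([unit_cycles_lift], [unit_reflects_boundaries]).  Finally a trivial
    fibration of bicomplexes totalises to a morphism that is surjective on
    r-cycles, because such a cycle of Tot A consists of an r-witness cycle, up to
    signs, followed by arbitrary components ([tot_cycle_surjective]).

    All complexes built here are periodic: the same filtered module with
    differential sits in every degree, so the sphere is the sum of the
    corepresenting complexes over all degrees.  Lifting problems are then solved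
    degree by degree, and elements of these complexes never have to be
    transported between degrees. *)

Set Implicit Arguments.
Unset Strict Implicit.
Unset Printing Implicit Defensive.

(** * Pages in terms of cycles and boundaries *)

Section Pages.
Import GRing.Theory Num.Theory Order.TTheory.
Local Open Scope ring_scope.
Variable R : comNzRingType.
Implicit Types A B X Y : fcomplex R.

Lemma submodB (V : lmodType R) (U : submodClosed V) x y :
  x \in U -> y \in U -> x - y \in U.
Proof. by move=> xU yU; rewrite -scaleN1r rpredD ?rpredZ. Qed.

Lemma ZcycE k p n m (e : n + 1 = m) A (x : A n) :
  (x \in Zcyc k p n A)
  = (x \in fc_F A p n) && (fc_d A e x \in fc_F A (p - k%:Z) m).
Proof. by case: m / e; rewrite inE. Qed.

Lemma fc_F_le A p q n (x : A n) :
  p <= q -> x \in fc_F A p n -> x \in fc_F A q n.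
Proof.
move=> pq xp; have -> : q = p + `|q - p|%N%:Z by lia.
elim: `|q - p|%N => [|j IH]; first by rewrite addr0.
by rewrite -addn1 PoszD addrA; apply: fc_FS.
Qed.

(** Membership in B_(k+1) with the cycle conditions on both summands of
    x = d y + z spelled out; since d d = 0, the condition on d z is one on d x.
    The degree of y is an arbitrary m with m + 1 = n, which spares transports to
    n - 1. *)
Lemma BbndE k p m n (e : m + 1 = n) A (x : A n) :
  x \in Bbnd k.+1 p n A <->
  exists y : A m, [/\ y \in fc_F A (p + k%:Z) m, fc_d A e y \in fc_F A p n,
    x - fc_d A e y \in fc_F A (p - 1) n
    & forall l (e' : n + 1 = l), fc_d A e' x \in fc_F A (p - k.+1%:Z) l].
Proof.
have em : m = n - 1 by rewrite -e addrK.
subst m; rewrite (eq_irrelevance e (subrK 1 n)).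
have pk : p + k%:Z - k%:Z = p by rewrite addrK.
have pk1 : p - 1 - k%:Z = p - k.+1%:Z by lia.
split=> [/asboolP[y [z [yZ zZ ->]]]|[y [yF dyF xyF dxF]]].
  exists y; move: yZ; rewrite (ZcycE _ _ (subrK 1 n)) pk => /andP[yF dyF].
  move: zZ; rewrite (ZcycE _ _ erefl) => /andP[zF dzF].
  split=> //; first by rewrite addrAC subrr add0r.
  move=> l el; move: dzF; case: l / el.
  by rewrite linearD fc_dd add0r pk1.
apply/asboolP; exists y, (x - fc_d A (subrK 1 n) y); split.
- by rewrite (ZcycE _ _ (subrK 1 n)) pk yF dyF.
- by rewrite (ZcycE _ _ erefl) xyF linearB fc_dd subr0 pk1 dxF.
- by rewrite addrC subrK.
Qed.

Definition acyclic k A :=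
  forall p n (x : A n), x \in Zcyc k p n A -> x \in Bbnd k p n A.

(** On pages this is injectivity. *)
Definition reflects_boundaries k A B (f : fhom A B) :=
  forall p n (x : A n), x \in Zcyc k p n A -> f n x \in Bbnd k p n B ->
  x \in Bbnd k p n A.

(** On pages this is surjectivity. *)
Definition cycles_lift_mod_boundaries k A B (f : fhom A B) :=
  forall p n (y : B n), y \in Zcyc k p n B ->
  exists2 x, x \in Zcyc k p n A & y - f n x \in Bbnd k p n B.

Lemma weq_reflects_boundaries k A B (f : fhom A B) :
  fC_weq k (f : @mor (fC R) A B) -> reflects_boundaries k.+1 f.
Proof.
move=> fW p n x xZ fxB; have /bij_inj f_inj := fW p n.
have /f_inj : page_map f (quotmod_pi (boundary k.+1 p n A) (Cycle xZ))
    = page_map f (quotmod_pi (boundary k.+1 p n A) 0).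
  by rewrite !page_mapE; apply/quotmod_piP; rewrite inE raddfB /= linear0 subr0.
by move/quotmod_piP; rewrite subr0 inE.
Qed.

Lemma weq_cycles_lift k A B (f : fhom A B) :
  fC_weq k (f : @mor (fC R) A B) -> cycles_lift_mod_boundaries k.+1 f.
Proof.
move=> fW p n y yZ; have [g _ gK] := fW p n.
have := gK (quotmod_pi (boundary k.+1 p n B) (Cycle yZ)).
move: (g _) => c; rewrite -[c]quotmod_reprK page_mapE => /esym/quotmod_piP.
rewrite inE raddfB /= => yB.
by exists (val (repr c)) => //; exact: cycle_valP.
Qed.

Lemma acyclic_page k p n A : acyclic k A -> forall x : page k p n A, x = 0.
Proof.
move=> A0 x; rewrite -[x]quotmod_reprK -[0 in RHS]quotmod_reprK.
by apply/quotmod_piP; rewrite inE; apply: A0; exact: cycle_valP.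
Qed.

Lemma acyclic_weq k A B (f : fhom A B) :
  acyclic k.+1 A -> acyclic k.+1 B -> fC_weq k (f : @mor (fC R) A B).
Proof.
move=> A0 B0 p n; exists (fun=> 0) => x.
  by rewrite [x](acyclic_page A0).
by rewrite [x](acyclic_page B0) linear0.
Qed.

Lemma acyclic_transfer k A B (f : fhom A B) :
  cycles_lift_mod_boundaries k f -> acyclic k A -> acyclic k B.
Proof.
move=> f_surj A0 p n y /f_surj[x /A0 xB yxB].
have [_ BP] := Bbnd_submod k p n B.
by rewrite -(subrK (f n x) y) -[_ + _]addrC -[y - _]scale1r addrC BP // fhom_Bbnd.
Qed.

End Pages.

(** * Periodic filtered complexes *)

Section Periodic.
Import GRing.Theory Num.Theory Order.TTheory.
Local Open Scope ring_scope.
Variable R : comNzRingType.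

(** What a filtered complex that is the same in every degree consists of. *)
Record dmodule := DModule {
  dm_mod :> lmodType R;
  dm_d : {linear dm_mod -> dm_mod};
  dm_dd : forall x, dm_d (dm_d x) = 0;
  dm_F : int -> submodClosed dm_mod;
  dm_FS : forall p x, x \in dm_F p -> x \in dm_F (p + 1);
  dm_Fd : forall p x, x \in dm_F p -> dm_d x \in dm_F p }.

Definition periodic (V : dmodule) : fcomplex R :=
  @FComplex R (fun=> V) (fun _ _ _ => dm_d V) (fun _ _ _ _ _ => @dm_dd V)
    (fun p _ => dm_F V p) (fun p _ => @dm_FS V p) (fun p _ _ _ => @dm_Fd V p).

Section Cell.
Variables (k : nat) (a : int).

Definition cell_d (x : R^o * R^o) : R^o * R^o := (0, x.1).

Lemma cell_d_linear : linear cell_d.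
Proof. by move=> c x y; rewrite /cell_d; congr pair; rewrite /= scaler0 addr0. Qed.

HB.instance Definition _ := GRing.isLinear.Build R _ _ *:%R cell_d cell_d_linear.

Definition cell_F (p : int) : {pred R^o * R^o} :=
  [pred x | ((p < a) ==> (x.1 == 0)) && ((p < a - k%:Z) ==> (x.2 == 0))].

Lemma cell_F_submod p : submod_closed (cell_F p).
Proof.
split=> [|c x y]; first by rewrite inE eqxx !implybT.
move=> /andP[/implyP x1 /implyP x2] /andP[/implyP y1 /implyP y2].
apply/andP; split; apply/implyP => pa /=.
  by rewrite (eqP (x1 pa)) (eqP (y1 pa)) scaler0 addr0.
by rewrite (eqP (x2 pa)) (eqP (y2 pa)) scaler0 addr0.
Qed.

HB.instance Definition _ p :=
  GRing.isSubmodClosed.Build R (R^o * R^o)%type (cell_F p) (cell_F_submod p).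

Lemma cell_dd x : cell_d (cell_d x) = 0. Proof. by []. Qed.

Lemma cell_FS p x : x \in cell_F p -> x \in cell_F (p + 1).
Proof.
move=> /andP[/implyP x1 /implyP x2]; apply/andP; split; apply/implyP => pa.
  by apply: x1; lia.
by apply: x2; lia.
Qed.

Lemma cell_Fd p x : x \in cell_F p -> cell_d x \in cell_F p.
Proof.
move=> /andP[/implyP x1 _]; rewrite inE /= eqxx implybT /=.
by apply/implyP => pa; apply: x1; lia.
Qed.

(** The sum over all degrees n of the complexes corepresenting Z_k^(a,a+n):
    the first coordinate is the universal cycle, of filtration a, and the second
    is its differential, of filtration a - k. *)
Definition cell : dmodule :=
  @DModule (R^o * R^o)%type cell_d cell_dd (fun p => cell_F p) cell_FS cell_Fd.

(** On the page E_k the differential cancels the two generators, so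
    the later pages vanish. *)
Lemma acyclic_cell l : (k < l)%N -> acyclic l (periodic cell).
Proof.
case: l => // l kl p n x.
rewrite (ZcycE _ _ (erefl (n + 1))) => /andP[xF dxF].
apply/(BbndE _ _ (subrK 1 n)); (* The second generator is the differential of the first. *)
exists ((x.2, 0) : periodic cell (n - 1)).
move: xF dxF => /andP[/implyP x1 /implyP x2] /andP[_ /implyP /= dx].
split=> //.
- apply/andP; split; last by rewrite eqxx implybT.
  by apply/implyP => pa; apply: x2; lia.
- apply/andP; split; first by rewrite eqxx implybT.
  by apply/implyP.
- apply/andP; split; apply/implyP => pa /=; last by rewrite subrr.
  by rewrite subr0; case: (ltP p a) => [/x1//|pa']; apply: dx; lia.
- by move=> _ _; apply/andP; split; [rewrite eqxx implybT | apply/implyP].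
Qed.

End Cell.

Section CellMap.
Variables (k : nat) (a : int) (X : fcomplex R) (z : forall n, X n).
Hypothesis zZ : forall n, z n \in Zcyc k a n X.

Definition cell_map n (x : periodic (cell k a) n) : X n :=
  (x.1 : R) *: z n + (x.2 : R) *: fc_d X (subrK 1 n) (z (n - 1)).

Lemma cell_map_linear n : linear (@cell_map n).
Proof.
by move=> c x y; rewrite /cell_map !scalerDl scalerDr !scalerA addrACA.
Qed.

HB.instance Definition _ n :=
  GRing.isLinear.Build R (periodic (cell k a) n) (X n) *:%R (@cell_map n)
    (@cell_map_linear n).

Lemma cell_map_d n m (e : n + 1 = m) x :
  cell_map (fc_d (periodic (cell k a)) e x) = fc_d X e (cell_map x).
Proof.
rewrite /cell_map /= scale0r add0r linearD !linearZ /= fc_dd scaler0 addr0.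
have en : n = m - 1 by rewrite -e addrK.
by subst n; rewrite (eq_irrelevance e (subrK 1 m)).
Qed.

Lemma cell_map_F p n x :
  x \in fc_F (periodic (cell k a)) p n -> cell_map x \in fc_F X p n.
Proof.
move=> /andP[/implyP x1 /implyP x2].
have /andP[zF _] := zZ n.
have := zZ (n - 1); rewrite (ZcycE _ _ (subrK 1 n)) => /andP[_ dzF].
apply: rpredD.
  case: (ltP p a) => [/x1/eqP->|pa]; first by rewrite scale0r rpred0.
  by apply: rpredZ; apply: fc_F_le zF.
case: (ltP p (a - k%:Z)) => [/x2/eqP->|pa]; first by rewrite scale0r rpred0.
by apply: rpredZ; apply: fc_F_le dzF.
Qed.

Definition cell_hom : fhom (periodic (cell k a)) X :=
  @FHom R (periodic (cell k a)) X (fun n => @cell_map n) cell_map_d cell_map_F.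

Lemma cell_hom_gen n : cell_hom n (1, 0) = z n.
Proof. by rewrite /= /cell_map scale1r scale0r addr0. Qed.

End CellMap.

Lemma cell_gen_cycle k a X (g : fhom (periodic (cell k a)) X) n :
  g n (1, 0) \in Zcyc k a n X.
Proof.
apply: fhom_Zcyc; apply/andP; split; apply/andP; split=> /=; rewrite ?eqxx ?implybT ?ltxx //.
Qed.

Lemma cell_hom_ext k a X (g h : fhom (periodic (cell k a)) X) :
  (forall n, g n (1, 0) = h n (1, 0)) -> g = h.
Proof.
move=> gh; apply: fhomP => n x.
have -> : x = (x.1 : R) *: ((1, 0) : periodic (cell k a) n)
    + (x.2 : R) *: fc_d (periodic (cell k a)) (subrK 1 n) (1, 0).
  by case: x => u v; congr pair; rewrite /= ?scaler0 ?addr0 ?add0r /GRing.scale /= mulr1.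
rewrite !linearD !linearZ.
by rewrite (fhom_d g (subrK 1 n) (1, 0)) (fhom_d h (subrK 1 n) (1, 0)) !gh.
Qed.

Section DirectSum.
Variables V W : dmodule.

Definition dsum_d (x : V * W) : V * W := (dm_d V x.1, dm_d W x.2).

Lemma dsum_d_linear : linear dsum_d.
Proof. by move=> c x y; rewrite /dsum_d /= !linearP. Qed.

HB.instance Definition _ := GRing.isLinear.Build R _ _ *:%R dsum_d dsum_d_linear.

Definition dsum_F (p : int) : {pred V * W} :=
  [pred x | (x.1 \in dm_F V p) && (x.2 \in dm_F W p)].

Lemma dsum_F_submod p : submod_closed (dsum_F p).
Proof.
split=> [|c x y /andP[x1 x2] /andP[y1 y2]]; first by rewrite inE !rpred0.
by rewrite inE /= !rpredD ?rpredZ.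
Qed.

HB.instance Definition _ p :=
  GRing.isSubmodClosed.Build R (V * W)%type (dsum_F p) (dsum_F_submod p).

Lemma dsum_dd x : dsum_d (dsum_d x) = 0.
Proof. by rewrite /dsum_d /= !dm_dd. Qed.

Lemma dsum_FS p x : x \in dsum_F p -> x \in dsum_F (p + 1).
Proof. by move=> /andP[x1 x2]; rewrite inE !dm_FS. Qed.

Lemma dsum_Fd p x : x \in dsum_F p -> dsum_d x \in dsum_F p.
Proof. by move=> /andP[x1 x2]; rewrite inE !dm_Fd. Qed.

Definition dsum : dmodule :=
  @DModule (V * W)%type dsum_d dsum_dd (fun p => dsum_F p) dsum_FS dsum_Fd.

Lemma acyclic_dsum k :
  acyclic k (periodic V) -> acyclic k (periodic W) -> acyclic k (periodic dsum).
Proof.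
move=> V0 W0 p n x /andP[/andP[x1F x2F] /andP[dx1F dx2F]].
have {V0} : x.1 \in Bbnd k p n (periodic V) by apply: V0; rewrite inE x1F.
have {W0} : x.2 \in Bbnd k p n (periodic W) by apply: W0; rewrite inE x2F.
case: k dx1F dx2F => [|k] dx1F dx2F; first by move=> x2B x1B; apply/andP.
move=> /(BbndE _ _ (subrK 1 n))[z [zF dzF xzF _]].
move=> /(BbndE _ _ (subrK 1 n))[y [yF dyF xyF _]].
apply/(BbndE _ _ (subrK 1 n)).
exists ((y, z) : periodic dsum (n - 1)).
by split=> [|||l el]; apply/andP; split.
Qed.

Section Copair.
Variables (X : fcomplex R) (g : fhom (periodic V) X) (h : fhom (periodic W) X).

Definition copair_map n (x : periodic dsum n) : X n := g n x.1 + h n x.2.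

Lemma copair_map_linear n : linear (@copair_map n).
Proof. by move=> c x y; rewrite /copair_map /= !linearP scalerDr addrACA. Qed.

HB.instance Definition _ n :=
  GRing.isLinear.Build R (periodic dsum n) (X n) *:%R (@copair_map n)
    (@copair_map_linear n).

Lemma copair_map_d n m (e : n + 1 = m) x :
  copair_map (fc_d (periodic dsum) e x) = fc_d X e (copair_map x).
Proof. by rewrite /copair_map linearD -!fhom_d. Qed.

Lemma copair_map_F p n x :
  x \in fc_F (periodic dsum) p n -> copair_map x \in fc_F X p n.
Proof. by move=> /andP[x1 x2]; apply: rpredD; apply: fhom_F. Qed.

Definition copair : fhom (periodic dsum) X :=
  @FHom R (periodic dsum) X (fun n => @copair_map n) copair_map_d copair_map_F.

End Copair.
End DirectSum.
End Periodic.

(** * The cofibration from the sphere to the disc *)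

Section Cofibration.
Import GRing.Theory Num.Theory Order.TTheory.
Local Open Scope ring_scope.
Variables (R : comNzRingType) (r : nat).

Definition cycle_surjective k (X Y : fcomplex R) (q : fhom X Y) :=
  forall p n (y : Y n), y \in Zcyc k p n Y -> exists2 x, x \in Zcyc k p n X & q n x = y.

(** Surjectivity on E_(k+1) lifts a (k+1)-cycle up to a boundary
    d w + z, and both w and z are k-cycles, which lift by hypothesis. *)
Lemma cycle_surjectiveS k (X Y : fcomplex R) (q : fhom X Y) :
  cycle_surjective k q -> fC_weq k (q : @mor (fC R) X Y) -> cycle_surjective k.+1 q.
Proof.
move=> q_surj qW p n y yZ.
have [x xZ yxB] := weq_cycles_lift qW yZ.
have [w [wF dwF zF dzF]] := (BbndE k p (subrK 1 n) _).1 yxB.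
have /q_surj[w' w'Z qw'] : w \in Zcyc k (p + k%:Z) (n - 1) Y.
  by rewrite (ZcycE _ _ (subrK 1 n)) addrK wF dwF.
set z := y - q n x - _ in zF.
have /q_surj[z' z'Z qz'] : z \in Zcyc k (p - 1) n Y.
  rewrite (ZcycE _ _ erefl) zF linearB fc_dd subr0.
  by rewrite (_ : p - 1 - k%:Z = p - k.+1%:Z) ?dzF //; lia.
exists (x + (fc_d X (subrK 1 n) w' + z')).
  move: w'Z z'Z; rewrite (ZcycE _ _ (subrK 1 n)) addrK => /andP[_ dw'F].
  rewrite (ZcycE _ _ erefl) => /andP[z'F dz'F].
  apply: rpredD => //; rewrite (ZcycE _ _ erefl) linearD fc_dd add0r.
  rewrite (_ : p - k.+1%:Z = p - 1 - k%:Z) ?dz'F ?andbT; last by lia.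
  by apply: rpredD => //; apply: fc_F_le z'F; lia.
by rewrite !linearD fhom_d qw' qz' /z [fc_d _ _ _ + _]addrC subrK addrC subrK.
Qed.

Lemma dsum_cell_hom_ext k a l b (X : fcomplex R)
    (g h : fhom (periodic (dsum (cell R k a) (cell R l b))) X) :
  (forall n, g n ((1, 0), 0) = h n ((1, 0), 0)) ->
  (forall n, g n (0, (1, 0)) = h n (0, (1, 0))) -> g = h.
Proof.
set D := periodic _ in g h * => gh1 gh2; apply: fhomP => n x.
have -> : x = ((x.1.1 : R) *: (((1, 0), 0) : D n)
      + (x.1.2 : R) *: fc_d D (subrK 1 n) ((1, 0), 0))
    + ((x.2.1 : R) *: ((0, (1, 0)) : D n)
      + (x.2.2 : R) *: fc_d D (subrK 1 n) (0, (1, 0))).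
  case: x => -[x1 x2] [x3 x4]; congr pair; congr pair;
    by rewrite /= ?scaler0 ?addr0 ?add0r /GRing.scale /= mulr1.
rewrite !(linearD, linearZ).
by rewrite !(fhom_d g (subrK 1 n)) !(fhom_d h (subrK 1 n)) !gh1 !gh2.
Qed.

Definition sphere := periodic (cell R r.+1 0).
Definition disc := periodic (dsum (cell R r r%:Z) (cell R r (- 1))).

Fact sphere_incl_cycle n :
  (((0, 1), (1, 0)) : disc n) \in Zcyc r.+1 0 n disc.
Proof.
rewrite inE; apply/andP; split; apply/andP; split; apply/andP; split=> //=; apply/implyP => ?;
  rewrite ?eqxx //; lia.
Qed.

Definition sphere_incl : fhom sphere disc := cell_hom sphere_incl_cycle.

(** Let x be a cycle of X with q x = d y1 + y2.  Injectivity of q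
    on E_(r+1) gives x = d x1 + x2, and then y1 - q x1 is an (r+1)-cycle because
    its differential is q x2 - y2.  Correcting x1 by a lift of this cycle, and x2
    accordingly, makes them lifts of y1 and y2. *)
Lemma sphere_incl_lift (X Y : fcomplex R) (q : fhom X Y) :
  cycle_surjective r q -> fC_weq r (q : @mor (fC R) X Y) ->
  has_lift (sphere_incl : @mor (fC R) sphere disc) (q : @mor (fC R) X Y).
Proof.
move=> q_surj qW; have qS_surj := cycle_surjectiveS q_surj qW.
move=> u v quv.
have quE n x : q n (u n x) = v n (sphere_incl n x)
  by have := congr1 (fun f : fhom _ _ => f n x) quv.
pose x n : X n := u n (1, 0).
pose y1 n : Y n := v n ((1, 0), 0).
pose y2 n : Y n := v n (0, (1, 0)).
have xZ n : x n \in Zcyc r.+1 0 n X by exact: (cell_gen_cycle u n).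
have y1Z n : y1 n \in Zcyc r r n Y.
  apply: fhom_Zcyc; rewrite inE; apply/andP.
  by split; apply/andP; split; apply/andP; split=> //=; apply/implyP => ?; rewrite ?eqxx //; lia.
have y2Z n : y2 n \in Zcyc r (- 1) n Y.
  apply: fhom_Zcyc; rewrite inE; apply/andP.
  by split; apply/andP; split; apply/andP; split=> //=; apply/implyP => ?; rewrite ?eqxx //; lia.
have qx m n (e : m + 1 = n) : q n (x n) = fc_d Y e (y1 m) + y2 n.
  rewrite quE /y1 -(fhom_d v e) -linearD cell_hom_gen; congr (v n (_, _)).
    by congr pair; rewrite /= addr0.
  by congr pair; rewrite /= add0r.
have lift_x1 m : { x1 : X m | [/\ x1 \in Zcyc r r m X, q m x1 = y1 m &
    forall n (e : m + 1 = n), x n - fc_d X e x1 \in Zcyc r (- 1) n X] }.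
  apply: cid.
  have xB : x (m + 1) \in Bbnd r.+1 0 (m + 1) X.
    apply: (weq_reflects_boundaries qW) => //.
    rewrite (qx m _ erefl); apply/(BbndE _ _ erefl); exists (y1 m).
    move: (y1Z m) (y2Z (m + 1)); rewrite !(ZcycE _ _ erefl) subrr add0r.
    move=> /andP[y1F dy1F] /andP[y2F dy2F]; split=> //; first by rewrite addrAC subrr !add0r.
    move=> l el; move: dy2F; case: l / el; rewrite linearD fc_dd add0r.
    by rewrite (_ : - 1 - r%:Z = 0 - r.+1%:Z) //; lia.
  have [x1 [x1F dx1F x2F dxF]] := (BbndE r 0 (erefl (m + 1)) _).1 xB.
  (* The correction of x1: an (r+1)-cycle, not only an r-cycle. *)
  have [|w wZ qw] := qS_surj r%:Z m (y1 m - q m x1).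
    rewrite add0r in x1F; move: (y1Z m) (y2Z (m + 1)).
    rewrite !(ZcycE _ _ erefl) => /andP[y1F dy1F] /andP[y2F _].
    apply/andP; split; first by apply: submodB => //; apply: fhom_F.
    have -> : fc_d Y (erefl (m + 1)) (y1 m - q m x1)
      = q (m + 1) (x (m + 1) - fc_d X erefl x1) - y2 (m + 1).
      by rewrite !linearB fhom_d (qx m _ erefl) addrAC addrK.
    rewrite (_ : r%:Z - r.+1%:Z = 0 - 1); last by lia.
    by apply: submodB; [apply: fhom_F | rewrite sub0r].
  exists (x1 + w); move: wZ; rewrite (ZcycE _ _ erefl) => /andP[wF dwF].
  move: x1F dx1F; rewrite add0r => x1F dx1F.
  rewrite (_ : r%:Z - r.+1%:Z = - 1) in dwF; last by lia.
  split.
  - rewrite (ZcycE _ _ erefl) linearD subrr !rpredD //.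
    by apply: fc_F_le dwF.
  - by rewrite linearD qw addrC subrK.
  - move=> n e; case: n / e; rewrite (ZcycE _ _ erefl) linearD opprD addrA.
    rewrite (_ : - 1 - r%:Z = 0 - r.+1%:Z); last by lia.
    rewrite !linearB !fc_dd !subr0 dxF andbT -[- 1]sub0r.
    by apply: submodB => //; rewrite sub0r.
pose x1 m := projT1 (lift_x1 m).
have x1P m : [/\ x1 m \in Zcyc r r m X, q m (x1 m) = y1 m &
    forall n (e : m + 1 = n), x n - fc_d X e (x1 m) \in Zcyc r (- 1) n X].
  exact: projT2 (lift_x1 m).
pose x2 n := x n - fc_d X (subrK 1 n) (x1 (n - 1)).
have x1Z n : x1 n \in Zcyc r r n X by have [] := x1P n.
have x2Z n : x2 n \in Zcyc r (- 1) n X by have [_ _] := x1P (n - 1); apply.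
exists (copair (cell_hom x1Z) (cell_hom x2Z) : @mor (fC R) disc X).
- apply: cell_hom_ext => n.
  change (copair (cell_hom x1Z) (cell_hom x2Z) n (sphere_incl n (1, 0)) = x n).
  rewrite cell_hom_gen /= /copair_map /= /cell_map /= !scale1r !scale0r.
  by rewrite add0r addr0 addrC subrK.
- apply: dsum_cell_hom_ext => n.
    change (q n (copair (cell_hom x1Z) (cell_hom x2Z) n ((1, 0), 0)) = y1 n).
    rewrite /= /copair_map /= /cell_map /= scale1r !scale0r !addr0.
    by have [] := x1P n.
  change (q n (copair (cell_hom x1Z) (cell_hom x2Z) n (0, (1, 0))) = y2 n).
  rewrite /= /copair_map /= /cell_map /= scale1r !scale0r !add0r addr0.
  have [_ qx1 _] := x1P (n - 1).
  by rewrite /x2 linearB fhom_d qx1 (qx _ _ (subrK 1 n)) addrAC subrr add0r.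
Qed.

End Cofibration.

(** * The obstruction *)

Section Obstruction.
Import GRing.Theory Num.Theory Order.TTheory.
Local Open Scope ring_scope.
Variable R : comNzRingType.

Section Point.

Definition point_F (p : int) : {pred R^o} := [pred x | (p < 0) ==> (x == 0)].

Lemma point_F_submod p : submod_closed (point_F p).
Proof.
split=> [|c x y]; first by rewrite inE eqxx implybT.
move=> /implyP x0 /implyP y0; apply/implyP => p0.
by rewrite (eqP (x0 p0)) (eqP (y0 p0)) scaler0 addr0.
Qed.

HB.instance Definition _ p :=
  GRing.isSubmodClosed.Build R R^o (point_F p) (point_F_submod p).

Lemma point_FS p x : x \in point_F p -> x \in point_F (p + 1).
Proof. by move=> /implyP x0; apply/implyP => p0; apply: x0; lia. Qed.

Lemma point_Fd p x : x \in point_F p -> (\0 : {linear R^o -> R^o}) x \in point_F p.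
Proof. by move=> _; rewrite inE eqxx implybT. Qed.

Definition point : dmodule R :=
  @DModule R R^o \0 (fun _ => erefl) (fun p => point_F p) point_FS point_Fd.

Lemma point_not_boundary k :
  (1 : R) \in Bbnd k.+1 0 0 (periodic point) -> False.
Proof.
move=> /(BbndE _ _ (subrK 1 0))[y [_ _ /implyP /= + _]].
by rewrite subr0 sub0r ltrN10 => /(_ isT); rewrite oner_eq0.
Qed.

Lemma point_cycle k : (1 : R) \in Zcyc k 0 0 (periodic point).
Proof. by rewrite inE; apply/andP; split; apply/implyP. Qed.

End Point.

Variable r : nat.

Fact sphere_point_cycle n : (1 : periodic point n) \in Zcyc r.+1 0 n (periodic point).
Proof. by rewrite inE; apply/andP; split; apply/implyP. Qed.

Definition sphere_point : fhom (sphere R r) (periodic point) := cell_hom sphere_point_cycle.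

Section ZeroMap.
Variables A B : fcomplex R.

Fact zero_hom_d n m (e : n + 1 = m) (x : A n) :
  (\0 : {linear A m -> B m}) (fc_d A e x) = fc_d B e ((\0 : {linear A n -> B n}) x).
Proof. by rewrite linear0. Qed.

Fact zero_hom_F p n (x : A n) :
  x \in fc_F A p n -> (\0 : {linear A n -> B n}) x \in fc_F B p n.
Proof. by move=> _; rewrite rpred0. Qed.

Definition zero_hom : fhom A B :=
  @FHom R A B (fun n => \0) zero_hom_d zero_hom_F.

End ZeroMap.

(** A map out of the disc writes the image of 1 as d x + y.
    This image is closed because 1 is, hence so is y, and an element of
    filtration -1 that is closed is an (r+1)-cycle. *)
Lemma cycle_extends_boundary (X : fcomplex R) (g : fhom (periodic point) X)
    (h : fhom (disc R r) X) :
  (forall n x, h n (sphere_incl R r n x) = g n (sphere_point n x)) ->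
  g 0 1 \in Bbnd r.+2 0 0 X.
Proof.
move=> hg; apply/(BbndE _ _ (subrK 1 0)).
have g1 : g 0 1 = fc_d X (subrK 1 0) (h (0 - 1) ((1, 0), 0)) + h 0 (0, (1, 0)).
  transitivity (g 0 (sphere_point 0 (1, 0))).
    by rewrite (cell_hom_gen sphere_point_cycle).
  rewrite -hg -(fhom_d h (subrK 1 0)) -linearD cell_hom_gen; congr (h 0 (_, _)).
    by congr pair; rewrite /= addr0.
  by congr pair; rewrite /= add0r.
exists (h (0 - 1) ((1, 0), 0)); split.
- apply: fhom_F; apply/andP; split; apply/andP; split=> //=; apply/implyP => ?;
  rewrite ?eqxx //; lia.
- rewrite -fhom_d; apply: fhom_F; apply/andP; split; apply/andP; split=> //=; apply/implyP => ?;
  rewrite ?eqxx //; lia.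
- rewrite g1 addrAC subrr add0r; apply: fhom_F;
  apply/andP; split; apply/andP; split=> //=; apply/implyP => ?;
  rewrite ?eqxx //; lia.
- by move=> l e'; rewrite -(fhom_d g e') linear0 rpred0.
Qed.

Section Functor.
Variables (D : category) (T : functor D (fC R)).
Local Open Scope cat_scope.

Definition universal_arrow (C : fC R) (L : D) (eta : mor C (T L)) :=
  forall X (g : mor C (T X)), exists! h : mor L X, fmap T h ∘ eta = g.

(** The complexes with a reflection along T that the page E_(r+2) does
    not see. *)
Definition page_reflective (C : fcomplex R) := exists (L : D) (eta : @mor (fC R) C (T L)),
  [/\ universal_arrow eta, reflects_boundaries r.+2 (eta : fhom C (T L))
    & cycles_lift_mod_boundaries r.+2 (eta : fhom C (T L))].

Variable N : model_data D.
Hypothesis N_model : is_model_structure N.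
Hypothesis N_weq : forall A B (f : mor A B), weq N f <-> fC_weq r.+1 (fmap T f).
Hypothesis N_cof : forall A B (i : mor A B),
  (forall X Y (q : mor X Y), cycle_surjective r (fmap T q : fhom _ _) ->
     fC_weq r (fmap T q) -> has_lift i q) ->
  cof N i.

(** The lifting problem of i' against q is the adjoint of that of i
    against T q. *)
Lemma transfer_lift (C C' : fC R) (L L' : D) (eta : mor C (T L)) (eta' : mor C' (T L'))
    (i : mor C C') (i' : mor L L') (X Y : D) (q : mor X Y) :
  universal_arrow eta -> universal_arrow eta' -> fmap T i' ∘ eta = eta' ∘ i ->
  has_lift i (fmap T q) -> has_lift i' q.
Proof.
move=> U U' i'i lift u v quv.
have [|h hi qh] := lift (fmap T u ∘ eta) (fmap T v ∘ eta').
  by rewrite compmA -fmapM quv fmapM -!compmA i'i.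
have [h' [h'E _]] := U' _ h.
exists h'.
  have [w [_ w_uniq]] := U _ (fmap T u ∘ eta).
  rewrite -(w_uniq u erefl); apply/esym/w_uniq.
  by rewrite fmapM -compmA i'i compmA h'E.
have [w [_ w_uniq]] := U' _ (fmap T v ∘ eta').
rewrite -(w_uniq v erefl); apply/esym/w_uniq.
by rewrite fmapM -compmA h'E.
Qed.

(** The zero map of the reflected point factors as a trivial
    cofibration j followed by a fibration.  The map from the sphere to the source
    of the fibration extends to the disc, so j kills the class of 1 in E_(r+2),
    although j is an isomorphism there. *)
Theorem cofibrations_and_weqs_incompatible :
  (forall V : dmodule R, page_reflective (periodic V)) -> False.
Proof.
move=> refl.
have [LS [etaS [US refS surS]]] := refl (cell R r.+1 0).
have [LD [etaD [UD refD surD]]] := refl (dsum (cell R r r%:Z) (cell R r (- 1))).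
have [LP [etaP [UP refP surP]]] := refl point.
have [i [iE _]] := US _ (etaD ∘ (sphere_incl R r : @mor (fC R) _ _)).
have [pr [prE _]] := US _ (etaP ∘ (sphere_point : @mor (fC R) _ _)).
have [zP [zPE _]] := UP _ (etaP ∘ (zero_hom (periodic point) (periodic point) : @mor (fC R) _ _)).
have [zD [zDE _]] := UD _ (etaP ∘ (zero_hom (disc R r) (periodic point) : @mor (fC R) _ _)).
have i_cof : cof N i.
  apply: N_cof => X Y q q_surj qW; apply: (transfer_lift US UD iE).
  exact: sphere_incl_lift.
have i_weq : weq N i.
  apply/N_weq; apply: acyclic_weq.
    by apply: (acyclic_transfer surS); apply: acyclic_cell.
  apply: (acyclic_transfer surD).
  by apply: acyclic_dsum; apply: acyclic_cell.
have [X [j [q [[j_cof j_weq] q_fib qj]]]] := trivcof_fib_factor N_model zP.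
have [|h hi _] := trivcof_fib_lift N_model i_cof i_weq q_fib (u := j ∘ pr) (v := zD).
  have [w [_ w_uniq]] := US _ (etaP ∘ (zero_hom (sphere R r) (periodic point) : @mor (fC R) _ _)).
  rewrite compmA qj; transitivity w; [apply/esym|]; apply: w_uniq.
    rewrite fmapM -compmA prE compmA zPE -compmA; congr (_ ∘ _).
    exact: fhomP.
  rewrite fmapM -compmA iE compmA zDE -compmA; congr (_ ∘ _).
  exact: fhomP.
apply: (@point_not_boundary r.+1).
apply: refP; first exact: point_cycle.
move/N_weq: j_weq => j_weq.
apply: (weq_reflects_boundaries j_weq).
  by apply: fhom_Zcyc; exact: point_cycle.
apply: (cycle_extends_boundary (g := fmap T j ∘ etaP) (h := fmap T h ∘ etaD)) => n x.
have := congr1 (fun g => (fmap T g ∘ etaS : fhom _ _) n x) hi.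
by rewrite !fmapM -!compmA iE prE; apply.
Qed.

End Functor.
End Obstruction.

(** * A left adjoint of the totalisation *)

Section QuotientLift.
Import GRing.Theory.
Local Open Scope ring_scope.
Variables (R : comNzRingType) (V W : lmodType R) (U : submodClosed V) (h : {linear V -> W}).

Definition quot_lift (hU : forall x, x \in U -> h x = 0) (x : quotmod U) : W := h (repr x).

Variable hU : forall x, x \in U -> h x = 0.

Lemma quot_lift_pi x : quot_lift hU (quotmod_pi U x) = h x.
Proof.
apply/eqP; rewrite -subr_eq0 -linearB; apply/eqP/hU.
by apply/quotmod_piP; exact: quotmod_reprK.
Qed.

Lemma quot_lift_linear : linear (quot_lift hU).
Proof.
move=> c x y; rewrite -[x]quotmod_reprK -[y]quotmod_reprK.
by rewrite -linearP !quot_lift_pi linearP.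
Qed.

HB.instance Definition _ :=
  GRing.isLinear.Build R (quotmod U) W *:%R (quot_lift hU) quot_lift_linear.

Lemma quotmod_pi0 x : x \in U -> quotmod_pi U x = 0.
Proof. by move=> xU; rewrite -[0](linear0 (quotmod_pi U)); apply/quotmod_piP; rewrite subr0. Qed.

End QuotientLift.

Arguments quot_lift {R V W U h} hU x : simpl never.

Section Detotalisation.
Import GRing.Theory Num.Theory Order.TTheory.
Local Open Scope ring_scope.
Variables (R : comNzRingType) (V : dmodule R).

Lemma dm_F_le p q x : p <= q -> x \in dm_F V p -> x \in dm_F V q.
Proof. exact: (@fc_F_le R (periodic V) p q 0). Qed.

(** The component of bidegree (i, i + n) is spanned by the symbols
    [c]_i, which vanish for c of filtration i - 1, and d_1 [c]_(i+1), which vanish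
    for c of filtration i.  There is no relation besides
    d_0 [c]_i + (-1)^n d_1 [c]_(i+1) = [d c]_i. *)
Definition detot_mod (s : bideg) : lmodType R :=
  (quotmod (dm_F V (s.1 - 1)) * quotmod (dm_F V s.1))%type.

Fact proj_quot p q (pq : p <= q) x : x \in dm_F V p -> quotmod_pi (dm_F V q) x = 0.
Proof. by move=> xF; apply/quotmod_pi0/(dm_F_le pq). Qed.

Fact d_quot p q (pq : p <= q) x :
  x \in dm_F V p -> (quotmod_pi (dm_F V q) \o dm_d V) x = 0.
Proof. by move=> xF; apply/quotmod_pi0/(dm_F_le pq)/dm_Fd. Qed.

Fact deg1_le (s t : bideg) : s + deg1 = t -> s.1 - 1 <= t.1.
Proof. by move=> <-. Qed.

Fact deg0_le (s t : bideg) : s + deg0 = t -> s.1 <= t.1.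
Proof. by move=> <- /=; rewrite addr0. Qed.

Fact deg0_le1 (s t : bideg) : s + deg0 = t -> s.1 - 1 <= t.1 - 1.
Proof. by move=> <- /=; rewrite addr0. Qed.

Fact deg0_le2 (s t : bideg) : s + deg0 = t -> s.1 - 1 <= t.1.
Proof. by move=> <- /=; rewrite addr0; lia. Qed.

Definition detot_sign (s : bideg) : R := (- 1) ^+ `|s.2 - s.1|%N.

Definition detot_d1 s t (e : s + deg1 = t) (x : detot_mod s) : detot_mod t :=
  (0, quot_lift (@proj_quot _ _ (deg1_le e)) x.1).

(** The second component is forced by the relation of [detot_mod]: the
    coordinate along d_1 [c]_(i+1) of d_0 [c]_i is -(-1)^n c. *)
Definition detot_d0 s t (e : s + deg0 = t) (x : detot_mod s) : detot_mod t :=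
  (quot_lift (@d_quot _ _ (deg0_le1 e)) x.1,
   quot_lift (@d_quot _ _ (deg0_le e)) x.2
     - detot_sign s *: quot_lift (@proj_quot _ _ (deg0_le2 e)) x.1).

Lemma detot_d1_linear s t (e : s + deg1 = t) : linear (detot_d1 e).
Proof. by move=> c x y; apply: (f_equal2 pair); rewrite /= ?scaler0 ?addr0 ?linearP. Qed.

Lemma detot_d0_linear s t (e : s + deg0 = t) : linear (detot_d0 e).
Proof.
move=> c x y; apply: (f_equal2 pair); rewrite /= ?linearP //.
by rewrite /= scalerDr addrACA.
Qed.

HB.instance Definition _ s t e := GRing.isLinear.Build R _ _ *:%R _ (@detot_d1_linear s t e).
HB.instance Definition _ s t e := GRing.isLinear.Build R _ _ *:%R _ (@detot_d0_linear s t e).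

Definition detot_pair s (u v : V) : detot_mod s :=
  (quotmod_pi (dm_F V (s.1 - 1)) u, quotmod_pi (dm_F V s.1) v).

Lemma detot_pairP s (x : detot_mod s) : exists u v, x = detot_pair s u v.
Proof. by exists (repr x.1), (repr x.2); rewrite /detot_pair !quotmod_reprK; case: x. Qed.

Lemma detot_pair_eq0 s u v :
  detot_pair s u v = 0 <-> u \in dm_F V (s.1 - 1) /\ v \in dm_F V s.1.
Proof.
split; last by move=> [uF vF]; rewrite /detot_pair !quotmod_pi0.
case; rewrite -[X in _ = X -> _](linear0 (quotmod_pi _)).
move=> /quotmod_piP; rewrite subr0 => uF.
rewrite -[X in _ = X -> _](linear0 (quotmod_pi _)).
by move=> /quotmod_piP; rewrite subr0.
Qed.

Lemma detot_d1E s t (e : s + deg1 = t) u v :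
  detot_d1 e (detot_pair s u v) = detot_pair t 0 u.
Proof. by rewrite /detot_d1 /= quot_lift_pi /detot_pair linear0. Qed.

Lemma detot_d0E s t (e : s + deg0 = t) u v :
  detot_d0 e (detot_pair s u v)
  = detot_pair t (dm_d V u) (dm_d V v - detot_sign s *: u).
Proof. by rewrite /detot_d0 /= !quot_lift_pi /detot_pair linearB (linearZZ (quotmod_pi _)). Qed.

Lemma detot_sign0 s t : s + deg0 = t -> detot_sign t = - detot_sign s.
Proof. by case: s => i j <-; apply: signr_absS; rewrite /=; lia. Qed.

Lemma detot_d0d0 s t w (e : s + deg0 = t) (e' : t + deg0 = w) x :
  detot_d0 e' (detot_d0 e x) = 0.
Proof.
have [u [v ->]] := detot_pairP x; rewrite !detot_d0E (detot_sign0 e) dm_dd.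
rewrite linearB linearZ /= dm_dd sub0r scaleNr opprK addNr.
by apply/detot_pair_eq0; rewrite !rpred0.
Qed.

Lemma detot_d1d1 s t w (e : s + deg1 = t) (e' : t + deg1 = w) x :
  detot_d1 e' (detot_d1 e x) = 0.
Proof.
have [u [v ->]] := detot_pairP x; rewrite !detot_d1E.
by apply/detot_pair_eq0; rewrite !rpred0.
Qed.

Lemma detot_d0d1 s t t' w (e1 : s + deg1 = t) (e0 : t + deg0 = w)
    (e0' : s + deg0 = t') (e1' : t' + deg1 = w) x :
  detot_d0 e0 (detot_d1 e1 x) = detot_d1 e1' (detot_d0 e0' x).
Proof.
have [u [v ->]] := detot_pairP x; rewrite detot_d1E !detot_d0E detot_d1E.
by rewrite linear0 scaler0 subr0.
Qed.

Definition detot : bicomplex R :=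
  @Bicomplex R detot_mod (fun s t e => detot_d0 e) (fun s t e => detot_d1 e)
    detot_d0d0 detot_d1d1 detot_d0d1.

Definition tot_pair n (c c' : int -> V) : Tot detot n :=
  fun i => detot_pair (i, i + n) (c i) (c' i).

Lemma tot_pairP n (x : Tot detot n) : exists c c', x = tot_pair n c c'.
Proof.
exists (fun i => repr (x i).1), (fun i => repr (x i).2).
apply: functional_extensionality_dep => i.
by rewrite /tot_pair /detot_pair !quotmod_reprK; case: (x i).
Qed.

Lemma tot_pairB n c c' b b' :
  tot_pair n c c' - tot_pair n b b'
  = tot_pair n (fun i => c i - b i) (fun i => c' i - b' i).
Proof.
apply: functional_extensionality_dep => i.
change (tot_pair n c c' i - tot_pair n b b' i =
  detot_pair (i, i + n) (c i - b i) (c' i - b' i)).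
by rewrite /tot_pair /detot_pair !linearB.
Qed.

Lemma tot_pair_F p n c c' :
  (tot_pair n c c' \in fc_F (Tot detot) p n) <->
  (forall i, p < i -> c i \in dm_F V (i - 1) /\ c' i \in dm_F V i).
Proof.
split=> [/asboolP xF i pi|xF]; first by apply/(detot_pair_eq0 (i, i + n))/xF.
by apply/asboolP => i pi; apply/detot_pair_eq0/xF.
Qed.

Lemma tot_pair_d n m (e : n + 1 = m) c c' :
  fc_d (Tot detot) e (tot_pair n c c')
  = tot_pair m (fun i => dm_d V (c i))
      (fun i => dm_d V (c' i) + (- 1) ^+ `|n|%N *: (c (i + 1) - c i)).
Proof.
apply: functional_extensionality_dep => i; rewrite /= /tot_d /= /tot_pair.
rewrite detot_d0E detot_d1E /detot_sign /= (_ : i + n - i = n); last by lia.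
rewrite /detot_pair /=; congr pair; rewrite /= ?linear0 ?scaler0 ?addr0 //.
by rewrite scalerBr !linearD !linearN !linearZ /= -addrA; congr (_ + _); exact: addrC.
Qed.

Definition unit_fun n (v : periodic V n) : Tot detot n :=
  tot_pair n (fun=> v) (fun=> 0).

Lemma unit_fun_linear n : linear (@unit_fun n).
Proof.
move=> c u v; apply: functional_extensionality_dep => i.
change (unit_fun (c *: u + v) i = c *: (unit_fun u i) + unit_fun v i).
by rewrite /unit_fun /tot_pair /detot_pair linearP linear0; congr pair; rewrite /= scaler0 addr0.
Qed.

HB.instance Definition _ n :=
  GRing.isLinear.Build R (periodic V n) (Tot detot n) *:%R (@unit_fun n) (@unit_fun_linear n).

Lemma unit_fun_d n m (e : n + 1 = m) v :
  unit_fun (fc_d (periodic V) e v) = fc_d (Tot detot) e (unit_fun v).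
Proof.
rewrite /unit_fun tot_pair_d; congr tot_pair; apply: funext => i.
by rewrite linear0 add0r subrr scaler0.
Qed.

Lemma unit_fun_F p n v :
  v \in fc_F (periodic V) p n -> unit_fun v \in fc_F (Tot detot) p n.
Proof.
move=> vF; apply/tot_pair_F => i pi; rewrite rpred0; split=> //.
by apply: dm_F_le vF; lia.
Qed.

Definition detot_unit : fhom (periodic V) (Tot detot) :=
  @FHom R _ _ (fun n => @unit_fun n) unit_fun_d unit_fun_F.

End Detotalisation.

(** * The unit of the adjunction on pages *)

Section UnitOnPages.
Import GRing.Theory Num.Theory Order.TTheory.
Local Open Scope ring_scope.
Variables (R : comNzRingType) (V : dmodule R).
Local Notation tot_pair := (@tot_pair R V).
Local Notation detot := (detot V).
Local Notation detot_unit := (detot_unit V).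

Let sgn (n : int) : R := (- 1) ^+ `|n|%N.

Let sgnK n : sgn n * sgn n = 1.
Proof. by rewrite /sgn -expr2 sqrr_sign. Qed.

(** The hypothesis on the boundary says that
    c i - c (i + 1) - sgn n d (c' i) has filtration i for p - k < i <= p.  The sum
    of these elements over p - j <= i <= p has filtration p and agrees with
    c (p - j) up to an exact term; only its summand i = p counts modulo F_(p-1). *)
Lemma staircase_descent k p n m (e : n + 1 = m) c c' :
  tot_pair n c c' \in fc_F (Tot detot) p n ->
  fc_d (Tot detot) e (tot_pair n c c') \in fc_F (Tot detot) (p - k%:Z) m ->
  forall j, (j < k)%N -> exists u w,
    [/\ u \in dm_F V p,
        u - (c p - sgn n *: dm_d V (c' p)) \in dm_F V (p - 1)
      & u - c (p - j%:Z) = dm_d V w].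
Proof.
move=> /tot_pair_F xF; rewrite tot_pair_d => /tot_pair_F dxF.
have step i : p - k%:Z < i -> c i - c (i + 1) - sgn n *: dm_d V (c' i) \in dm_F V i.
  move=> /dxF[_ /(rpredZ (- sgn n))].
  rewrite scalerDr scalerA -/(sgn n) mulNr sgnK scaleN1r scaleNr opprB.
  by rewrite addrC.
elim=> [|j IH] jk.
  (* c (p + 1) has filtration p, so the first difference reduces to c p. *)
  exists (c p - sgn n *: dm_d V (c' p)), (- (sgn n *: c' p)); split.
  - have /step : p - k%:Z < p by lia.
    have /xF[] : p < p + 1 by lia.
    rewrite addrK => cF _ /(rpredD cF).
    rewrite [c (p + 1) + _]addrC [c p - _ - _]addrAC subrK; exact.
  - by rewrite subrr rpred0.
  - by rewrite subr0 addrAC subrr sub0r linearN (linearZZ (dm_d V)).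
have [u [w [uF ucF uE]]] := IH (ltnW jk).
pose i := p - j.+1%:Z.
have iS : i + 1 = p - j%:Z by rewrite /i; lia.
have /step sF : p - k%:Z < i by rewrite /i; lia.
rewrite iS in sF; set s := (X in X \in _) in sF.
exists (u + s), (w - sgn n *: c' i); split.
- by apply: rpredD => //; apply: dm_F_le sF; rewrite /i; lia.
- by rewrite addrAC; apply: rpredD => //; apply: dm_F_le sF; rewrite /i; lia.
- rewrite linearB (linearZZ (dm_d V)) -uE /s /= -/i.
  by rewrite -[c i - _ - _]addrA [c i + _]addrC addrA addrK addrA.
Qed.

(** The element u of [staircase_descent] for j = k has the same
    differential as c (p - k), of filtration p - k - 1, so it is a (k+1)-cycle.
    What remains of x - u at index p is the boundary of an element supported
    there. *)
Lemma unit_approximates k p n l (e : l + 1 = n) (x : Tot detot n) :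
  x \in Zcyc k.+1 p n (Tot detot) ->
  exists (u : V) (y : Tot detot l),
    [/\ (u : periodic V n) \in Zcyc k.+1 p n (periodic V),
        y \in fc_F (Tot detot) p l, fc_d (Tot detot) e y \in fc_F (Tot detot) p n
      & x - detot_unit n u - fc_d (Tot detot) e y \in fc_F (Tot detot) (p - 1) n].
Proof.
have [c [c' ->]] := tot_pairP x; rewrite (ZcycE _ _ erefl) => /andP[xF dxF].
have [u [w [uF ucF uE]]] := staircase_descent xF dxF (ltnSn k).
move: xF dxF; rewrite tot_pair_d => /tot_pair_F xF /tot_pair_F dxF.
(* At index p, the pair (c p - u, c' p) is the boundary of sgn c' p up to
   F_(p-1). *)
exists u, (tot_pair l (fun i => if i == p then sgn n *: c' p else 0) (fun=> 0)).
rewrite tot_pair_d; split.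
- rewrite inE; apply/andP; split=> //=.
  rewrite -(subrK (c (p - k%:Z)) u) uE linearD dm_dd add0r.
  have /dxF[+ _] : p - k.+1%:Z < p - k%:Z by lia.
  by apply: dm_F_le; lia.
- by apply/tot_pair_F => i pi; rewrite gt_eqF // !rpred0.
- apply/tot_pair_F => i pi.
  have [-> ->] : (i == p) = false /\ (i + 1 == p) = false by split; apply/eqP; lia.
  by rewrite linear0 subrr scaler0 addr0 !rpred0.
rewrite /= /unit_fun !tot_pairB; apply/tot_pair_F => i pi.
have [->|ip] := eqVneq i p.
  rewrite (_ : (p + 1 == p) = false) /=; last by apply/eqP; lia.
  split.
    move: ucF => /(rpredZ (-1 : R)); rewrite scaleN1r opprB (linearZZ (dm_d V)).
    by rewrite addrAC.
  rewrite sub0r subr0 linear0 add0r scalerN scalerA.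
  rewrite /sgn (signr_absS R e) mulrN -expr2 sqrr_sign scaleN1r opprK subrr.
  exact: rpred0.
have {}pi : p < i by lia.
have -> : (i + 1 == p) = false by apply/eqP; lia.
rewrite linear0; have [ciF c'iF] := xF i pi.
rewrite !subr0 scaler0 addr0 subr0; split=> //.
by apply: submodB => //; apply: dm_F_le uF; lia.
Qed.

Lemma unit_cycles_lift k : cycles_lift_mod_boundaries k.+1 detot_unit.
Proof.
move=> p n x xZ; have [u [y [uZ yF dyF xyF]]] := unit_approximates (subrK 1 n) xZ.
exists u => //; apply/(BbndE _ _ (subrK 1 n)); exists y; split=> //.
  by apply: fc_F_le yF; lia.
move=> l e; have := fhom_Zcyc detot_unit uZ; move: xZ.
rewrite !(ZcycE _ _ e) => /andP[_ dxF] /andP[_ duF].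
by rewrite linearB; apply: submodB.
Qed.

Lemma corrected_boundaryE (A B : fcomplex R) (f : fhom A B) m l n
    (e' : m + 1 = l) (e : l + 1 = n) (b : A l) (y : B l) (z : B m) :
  fc_d B e (y - f l b - fc_d B e' z) = fc_d B e y - f n (fc_d A e b).
Proof. by rewrite !linearB fc_dd subr0 fhom_d. Qed.

Lemma corrected_differenceE (A B : fcomplex R) (f : fhom A B) m l n
    (e' : m + 1 = l) (e : l + 1 = n) (u : A n) (b : A l) (y : B l) (z : B m) :
  f n (u - fc_d A e b) - fc_d B e (y - f l b - fc_d B e' z) = f n u - fc_d B e y.
Proof. by rewrite corrected_boundaryE linearB opprB addrA subrK. Qed.

(** Replacing y by an approximation in the image of the unit
    lowers its filtration by 1 at the cost of changing u by a boundary.  When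
    the filtration has reached p, the component of index p of the equation
    gives the last correction. *)
Lemma unit_boundary_descent p m n l (e : l + 1 = n) (u : periodic V n) (y : Tot detot l) :
  y \in fc_F (Tot detot) (p + m%:Z) l -> fc_d (Tot detot) e y \in fc_F (Tot detot) p n ->
  detot_unit n u - fc_d (Tot detot) e y \in fc_F (Tot detot) (p - 1) n ->
  exists b : V, [/\ b \in dm_F V (p + m%:Z), dm_d V b \in dm_F V p
    & u - dm_d V b \in dm_F V (p - 1)].
Proof.
elim: m u y => [|m IH] u y yF dyF uyF.
  move: yF dyF uyF; rewrite addr0.
  have [b [b' ->]] := tot_pairP y; rewrite tot_pair_d => /tot_pair_F yF _.
  rewrite /= /unit_fun tot_pairB => /tot_pair_F uyF.
  have /uyF[uF /(rpredZ (sgn l))] : p - 1 < p by lia.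
  have /yF[] : p < p + 1 by lia.
  rewrite addrK sub0r => bF _ b'F.
  have bb'F : b p - sgn l *: dm_d V (b' p) \in dm_F V p.
    have := rpredD bF b'F.
    rewrite scalerN scalerDr scalerA -/(sgn l) sgnK scale1r opprD opprB.
    by rewrite addrCA [b (p + 1) + _]addrC subrK addrC.
  exists (b p - sgn l *: dm_d V (b' p)); split=> //.
  - by apply: dm_Fd.
  - by rewrite linearB (linearZZ (dm_d V)) dm_dd scaler0 subr0.
have pmE : p + m%:Z = p + m.+1%:Z - 1 by clear; lia.
have yZ : y \in Zcyc m.+1 (p + m.+1%:Z) l (Tot detot).
  by rewrite (ZcycE _ _ e) addrK yF.
have [b [z [bZ zF dzF yzF]]] := unit_approximates (subrK 1 l) yZ.
move: bZ; rewrite (ZcycE _ _ e) addrK => /andP[bF dbF].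
have [| | |b2 [b2F db2F ub2F]] := IH (u - dm_d V b)
  (y - detot_unit l b - fc_d (Tot detot) (subrK 1 l) z).
- by rewrite pmE.
- by rewrite corrected_boundaryE; apply: submodB => //; apply: fhom_F.
- by rewrite (corrected_differenceE detot_unit).
exists (b + b2); rewrite linearD; split.
- by apply: rpredD; [exact: bF | apply: dm_F_le b2F; rewrite pmE gerBl].
- exact: rpredD.
- by rewrite opprD addrA.
Qed.

Lemma unit_reflects_boundaries k : reflects_boundaries k.+1 detot_unit.
Proof.
move=> p n u uZ /(BbndE _ _ (subrK 1 n))[y [yF dyF uyF _]].
have [b [bF dbF ubF]] := unit_boundary_descent yF dyF uyF.
apply/(BbndE _ _ (subrK 1 n)); exists b; split=> // l e.
by move: uZ; rewrite (ZcycE _ _ e) => /andP[].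
Qed.

End UnitOnPages.

(** * The universal property of the unit *)

Section Transport.
Import GRing.Theory Num.Theory Order.TTheory.
Local Open Scope ring_scope.
Variables (R : comNzRingType).

(** Bidegrees such as (i, i + (j - i)) and (i, j), or (p - j, p - j + n) and
    (p - j, p + n - j), are equal but not convertible. *)
Definition transport (X : bicomplex R) s t (e : s = t) (x : X s) : X t := ecast t (X t) e x.

Lemma transport_linear (X : bicomplex R) s t (e : s = t) : linear (@transport X s t e).
Proof. by case: t / e. Qed.

HB.instance Definition _ X s t e :=
  GRing.isLinear.Build R _ _ *:%R _ (@transport_linear X s t e).

Lemma transport_id (X : bicomplex R) s (e : s = s) (x : X s) : transport e x = x.
Proof. by rewrite (eq_irrelevance e erefl). Qed.

Section Adjoint.
Variables (V : dmodule R) (X : bicomplex R) (g : fhom (periodic V) (Tot X)).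

Fact bideg_shift (s : bideg) : (s.1, s.1 + (s.2 - s.1)) = s.
Proof. by case: s => i j; rewrite /= addrC subrK. Qed.

(** The image of the symbol [v]_i in bidegree s = (i, j). *)
Definition adj_comp (s : bideg) (v : V) : X s :=
  transport (bideg_shift s) (g (s.2 - s.1) v s.1).

Lemma adj_comp_linear s : linear (adj_comp s).
Proof. by move=> c u v; rewrite /adj_comp linearP; exact: linearP. Qed.

HB.instance Definition _ s := GRing.isLinear.Build R _ _ *:%R _ (adj_comp_linear s).

Lemma adj_compE i n v : adj_comp (i, i + n) v = g n v i.
Proof.
rewrite /adj_comp; move: (bideg_shift _) => /=.
have -> : i + n - i = n by lia.
by move=> e; rewrite transport_id.
Qed.

Lemma adj_comp_F p s v : v \in dm_F V p -> p < s.1 -> adj_comp s v = 0.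
Proof.
move=> vF ps; rewrite /adj_comp.
have /asboolP -> // : g (s.2 - s.1) v \in fc_F (Tot X) p (s.2 - s.1).
  exact: fhom_F.
exact: linear0.
Qed.

(** The relation between the symbols holds in X because g commutes with the
    differentials. *)
Lemma adj_comp_d s t s' (e0 : s + deg0 = t) (e1 : s' + deg1 = t) v :
  adj_comp t (dm_d V v)
  = bc_d0 X e0 (adj_comp s v) + detot_sign R s *: bc_d1 X e1 (adj_comp s' v).
Proof.
case: s s' t e0 e1 => [i j] [i' j'] [i'' j''] e0 e1.
have [n jE] : exists n, j = i + n by exists (j - i); lia.
have [i''E j''E] : i'' = i /\ j'' = i + (n + 1).
  by case: (e0); rewrite /deg0 /= => <- <-; lia.
have [i'E j'E] : i' = i + 1 /\ j' = i + 1 + n.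
  by case: (e1); rewrite /deg1 /= => ? ?; lia.
subst j i'' j'' i' j'; rewrite !adj_compE /detot_sign /=.
have -> : g (n + 1) (dm_d V v) = tot_d (erefl (n + 1)) (g n v).
  exact: (fhom_d g (erefl (n + 1)) v).
rewrite /tot_d (_ : i + n - i = n); last by lia.
by rewrite (eq_irrelevance e0 (tot_deg0 i erefl)) (eq_irrelevance e1 (tot_deg1 i erefl)).
Qed.

Fact adj_lift1_proof s x : x \in dm_F V (s.1 - 1) -> adj_comp s x = 0.
Proof. by move=> xF; apply: (adj_comp_F xF); rewrite ltrBlDr ltrDl. Qed.

Fact adj_lift2_proof (s : bideg) x : x \in dm_F V s.1 -> adj_comp (s.1 + 1, s.2) x = 0.
Proof. by move=> xF; apply: (adj_comp_F xF); rewrite ltrDl. Qed.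

Fact adj_deg1 (s : bideg) : (s.1 + 1, s.2) + deg1 = s.
Proof. by case: s => i j; congr pair; rewrite /= ?addrK ?addr0. Qed.

Definition adj_fun s (x : detot V s) : X s :=
  quot_lift (@adj_lift1_proof s) x.1
  + bc_d1 X (adj_deg1 s) (quot_lift (@adj_lift2_proof s) x.2).

Lemma adj_fun_linear s : linear (@adj_fun s).
Proof. by move=> c x y; rewrite /adj_fun /= !linearP scalerDr addrACA. Qed.

HB.instance Definition _ s :=
  GRing.isLinear.Build R (detot V s) (X s) *:%R (@adj_fun s) (adj_fun_linear (s:=s)).

Lemma adj_funE s u v : adj_fun (detot_pair s u v)
  = adj_comp s u + bc_d1 X (adj_deg1 s) (adj_comp (s.1 + 1, s.2) v).
Proof. by rewrite /adj_fun /= !quot_lift_pi. Qed.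

Lemma adj_fun_d0 s t (e : s + deg0 = t) (x : detot V s) :
  adj_fun (bc_d0 (detot V) e x) = bc_d0 X e (adj_fun x).
Proof.
have [u [v ->]] := detot_pairP x; rewrite /= detot_d0E !adj_funE.
have tE : t.1 = s.1 by rewrite -e /= addr0.
have t2E : t.2 = s.2 + 1 by rewrite -e.
have es : (s.1 + 1, s.2) + deg0 = (t.1 + 1, t.2).
  by rewrite tE t2E; congr pair; rewrite /= addr0.
have -> : adj_comp (t.1 + 1, t.2) (dm_d V v - detot_sign R s *: u)
    = bc_d0 X es (adj_comp (s.1 + 1, s.2) v)
      + detot_sign R (s.1 + 1, s.2) *: bc_d1 X (adj_deg1 _) (adj_comp _ v)
      - detot_sign R s *: adj_comp (t.1 + 1, t.2) u.
  by rewrite -(adj_comp_d es (adj_deg1 _)) linearB (linearZZ (adj_comp _)).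
rewrite (adj_comp_d e (adj_deg1 t)) linearB (linearZZ (bc_d1 X _)) linearD.
rewrite (linearZZ (bc_d1 X _)) bc_d1d1 scaler0 addr0.
rewrite -(bc_d0d1 (adj_deg1 s) e es (adj_deg1 t)) linearD.
by rewrite [bc_d0 X e _ + _ + _]addrAC addrA subrK.
Qed.

Lemma adj_fun_d1 s t (e : s + deg1 = t) (x : detot V s) :
  adj_fun (bc_d1 (detot V) e x) = bc_d1 X e (adj_fun x).
Proof.
have [u [v ->]] := detot_pairP x; rewrite /= detot_d1E !adj_funE.
rewrite linear0 add0r linearD bc_d1d1 addr0.
have : (t.1 + 1, t.2) = s.
  by rewrite -e; case: (s) => i j; congr pair; rewrite /= ?addr0 ?subrK.
move: (adj_deg1 t) => e'.
move: (_, _) e' => s' e' es; subst s'.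
by rewrite (eq_irrelevance e e').
Qed.

Definition adj_hom : bhom (detot V) X := @BHom R _ _ (fun s => @adj_fun s) adj_fun_d0 adj_fun_d1.

Lemma adj_hom_unit n v : Tot_map adj_hom n (detot_unit V n v) = g n v.
Proof.
apply: functional_extensionality_dep => i.
change (adj_fun (detot_pair (i, i + n) v 0) = g n v i).
by rewrite adj_funE adj_compE !linear0 addr0.
Qed.

Lemma bhom_detot_ext (h h' : bhom (detot V) X) :
  (forall n v, Tot_map h n (detot_unit V n v) = Tot_map h' n (detot_unit V n v)) -> h = h'.
Proof.
move=> hh.
have h1 s u : h s (detot_pair s u 0) = h' s (detot_pair s u 0).
  case: s => i j; have [n ->] : exists n, j = i + n by exists (j - i); lia.
  exact: (congr1 (fun x : Tot X n => x i) (hh n u)).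
apply: bhomP => s x; have [u [v ->]] := detot_pairP x.
have -> : detot_pair s u v = detot_pair s u 0
    + bc_d1 (detot V) (adj_deg1 s) (detot_pair _ v 0).
  by rewrite /= detot_d1E; congr pair; rewrite /= linear0 ?addr0 ?add0r.
by rewrite !linearD !bhom_d1 !h1.
Qed.

End Adjoint.
End Transport.

(** * Totalising witness cycles *)

Section WitnessCycles.
Import GRing.Theory Num.Theory Order.TTheory.
Local Open Scope ring_scope.
Variables (R : comNzRingType).
Implicit Types X Y : bicomplex R.

Definition witness_surjective k X Y (q : bhom X Y) :=
  forall (p n : int) (b : witness_family k p n Y), is_witness_cycle b ->
  exists2 a : witness_family k p n X, is_witness_cycle a & witness_map q a = b.

Lemma transportK X s t (e : s = t) (e' : t = s) (x : X s) :
  transport e' (transport e x) = x.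
Proof. by subst t; rewrite !transport_id. Qed.

Lemma transport_comp X n (y : tot_mod X n) i i' s
    (e : (i', i' + n) = s) (e' : s = (i, i + n)) :
  transport e' (transport e (y i')) = y i.
Proof.
have i'i : i' = i by have := etrans e e'; case.
by subst i'; exact: transportK.
Qed.

Lemma bhom_transport X Y (q : bhom X Y) s t (e : s = t) (x : X s) :
  q t (transport e x) = transport e (q s x).
Proof. by subst t. Qed.

(** The vanishing of a component of the total differential, up to sign,
    is the condition on consecutive entries of a witness cycle. *)
Lemma tot_d_eq0 X n (y : tot_mod X n) l l' s s' t (el : l' = l + 1)
    (e : (l, l + n) = s) (e' : (l', l' + n) = s')
    (e0 : s + deg0 = t) (e1 : s' + deg1 = t) :
  tot_d (erefl (n + 1)) y l = 0 <->
  bc_d0 X e0 (transport e (y l))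
    = - (-1) ^+ `|n|%N *: bc_d1 X e1 (transport e' (y l')).
Proof.
subst l' s s'; rewrite !transport_id.
have tE : t = (l, l + (n + 1)) by rewrite -e0; exact: tot_deg0.
move: e0 e1; rewrite tE => e0 e1; rewrite /tot_d (eq_irrelevance e0 (tot_deg0 l erefl)).
rewrite (eq_irrelevance e1 (tot_deg1 l erefl)) scaleNr.
by split=> [/eqP|->]; [rewrite addr_eq0 => /eqP | rewrite addNr].
Qed.

Fact witness_index (p n j i : int) : p - j = i -> (p - j, p + n - j) = (i, i + n).
Proof. by move=> <-; congr pair; lia. Qed.

Fact witness_deg1 (p n i j : int) : j = i + 1 ->
  (p - i, p + n - i) + deg1 = (p - j, p + n - j) + deg0.
Proof. by move=> ->; congr pair; rewrite /=; lia. Qed.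

(** For a cycle y of filtration p, the components y (p - j), for j < k
    and up to the sign eps ^ j, form a k-witness cycle and lift as such.  The
    components below p - k + 1 are unconstrained and lift one by one. *)
Lemma tot_cycle_surjective k X Y (q : bhom X Y) :
  witness_surjective 0 q -> witness_surjective k q ->
  cycle_surjective k (Tot_map q).
Proof.
move=> q0 qk p n y; rewrite (ZcycE _ _ erefl) => /andP[/asboolP yF /asboolP dyF].
have lift0 i : exists x, q (i, i + n) x = y i.
  by have [x _] := q0 i n (y i) I; exists x.
case: k qk dyF => [|k] qk dyF.
  have /(_ _)/cid ch i : exists x, q (i, i + n) x = y i /\ (p < i -> x = 0).
    case: (ltP p i) => pi; first by exists 0; rewrite linear0 yF.
    by have [x qx] := lift0 i; exists x.
  pose x : Tot X n := fun i => projT1 (ch i).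
  have xF : x \in tot_F X p n by apply/asboolP => i; rewrite /x; case: (ch i) => ? [].
  exists x.
    by rewrite (ZcycE _ _ erefl) subr0; apply/andP; split=> //; apply: tot_Fd.
  apply: functional_extensionality_dep => i.
  by rewrite /= /tot_map /x; case: (ch i) => ? [].
(* In Tot, d_0 y_i = eps d_1 y_(i+1) where a witness cycle has no sign. *)
pose eps : R := - (-1) ^+ `|n|%N.
have epsK : eps * eps = 1 by rewrite /eps mulrNN -expr2 sqrr_sign.
have epsXK j : eps ^+ j * eps ^+ j = 1 by rewrite -exprMn epsK expr1n.
pose b : witness_family k.+1 p n Y := fun j : 'I_k.+1 =>
  eps ^+ j *: transport (esym (witness_index n (erefl (p - j%:Z)))) (y (p - j%:Z)).
have d0y (j : 'I_k.+1) l' (l'E : l' = p - j%:Z + 1) s' (e' : (l', l' + n) = s') t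
    (e0 : (p - j%:Z, p + n - j%:Z) + deg0 = t) (e1 : s' + deg1 = t) :
    bc_d0 Y e0 (transport (esym (witness_index n (erefl (p - j%:Z)))) (y (p - j%:Z)))
    = eps *: bc_d1 Y e1 (transport e' (y l')).
  by apply/(tot_d_eq0 _ l'E)/dyF; have := ltn_ord j; lia.
have bW : is_witness_cycle b.
  split=> [|i j ji t e0 e1].
    have e1 : (p + 1, p + 1 + n) + deg1 = (p - 0%:Z, p + n - 0%:Z) + deg0.
      by congr pair; rewrite /=; lia.
    rewrite /b linearZ /= (d0y ord0 (p + 1) _ _ erefl _ _ e1) ?subr0 // yF ?linear0 ?scaler0 //.
    by rewrite ltrDl.
  rewrite /b !linearZ /=.
  rewrite (d0y j (p - i%:Z) _ _ (esym (witness_index n (erefl (p - i%:Z)))) _ e0 e1); last first.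
    by rewrite ji; lia.
  by rewrite scalerA ji exprSr -mulrA epsK mulr1.
have [a [a0 aS] qa] := qk p n b bW.
have qaj j : q _ (a j) = b j by exact: (congr1 (fun f : witness_family k.+1 p n Y => f j) qa).
have /(_ _)/cid ch i : exists x : X (i, i + n), [/\ q (i, i + n) x = y i, p < i -> x = 0
    & forall (j : 'I_k.+1) (e : (p - j%:Z, p + n - j%:Z) = (i, i + n)),
        x = eps ^+ j *: transport e (a j)].
  have [pi|ip] := ltP p i.
    exists 0; rewrite linear0 yF //; split=> // j e.
    by have /= ij := congr1 fst e; exfalso; move: pi ij; clear; lia.
  have [ik|ki] := boolP (`|(p - i)%R| < k.+1)%N; last first.
    have [x qx] := lift0 i; exists x; split=> // j e.
    by have /= ij := congr1 fst e; exfalso; move: ij ki (ltn_ord j); clear; lia.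
  pose j0 := Ordinal ik.
  have j0E : p - j0%:Z = i by rewrite /=; lia.
  exists (eps ^+ j0 *: transport (witness_index n j0E) (a j0)); split.
  - rewrite linearZZ bhom_transport (qaj j0) /b linearZZ scalerA epsXK scale1r.
    exact: transport_comp.
  - by [].
  - move=> j e; have jE : j0 = j by apply: ord_inj; have := congr1 fst e; rewrite /=; lia.
    by subst j; rewrite (eq_irrelevance e (witness_index n j0E)).
pose x : Tot X n := fun i => projT1 (ch i).
have qx i : q (i, i + n) (x i) = y i by rewrite /x; case: (ch i) => ? [].
have x0 i : p < i -> x i = 0 by rewrite /x; case: (ch i) => ? [].
have xE (j : 'I_k.+1) i (e : (i, i + n) = (p - j%:Z, p + n - j%:Z)) :
    transport e (x i) = eps ^+ j *: a j.
  rewrite /x; case: (ch i) => z [_ _ /(_ j (esym e)) /= ->].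
  by rewrite linearZ /= transportK.
have xF : x \in tot_F X p n by apply/asboolP.
exists x; last by apply: functional_extensionality_dep => i; exact: qx.
rewrite (ZcycE _ _ erefl); apply/andP; split=> //; apply/asboolP => i ki.
have [pi|ip] := ltP p i.
  by have /asboolP dxF := tot_Fd (erefl (n + 1)) xF; exact: dxF.
have jk : (`|(p - i)%R| < k.+1)%N by lia.
pose j := Ordinal jk.
have jE : p - j%:Z = i by rewrite /=; lia.
have e := esym (witness_index n jE).
case: (posnP j) => [j0|j_gt0].
  have e1 : (i + 1, i + 1 + n) + deg1 = (p - j%:Z, p + n - j%:Z) + deg0.
    by congr pair; rewrite /=; lia.
  apply/(tot_d_eq0 _ erefl e erefl erefl e1).
  rewrite xE x0 ?linear0 ?scaler0; last by move: j0 => /=; lia.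
  have -> : j = ord0 by apply: ord_inj.
  by rewrite linearZ /= a0 scaler0.
have j'k : (j.-1 < k.+1)%N by rewrite (leq_ltn_trans (leq_pred _)).
pose j' := Ordinal j'k.
have j'E : p - j'%:Z = i + 1 by move: j_gt0 => /=; lia.
have e' := esym (witness_index n j'E).
have e1 : (p - j'%:Z, p + n - j'%:Z) + deg1 = (p - j%:Z, p + n - j%:Z) + deg0.
  by apply: witness_deg1; move: j_gt0 => /=; lia.
apply/(tot_d_eq0 _ erefl e e' erefl e1); rewrite !xE.
rewrite (linearZZ (bc_d0 X _)) (linearZZ (bc_d1 X _)).
rewrite (aS j' j _ _ erefl e1); last by rewrite prednK.
by rewrite scalerA -/eps -exprS prednK.
Qed.

End WitnessCycles.

(** * Non-existence of the localisations *)

Section Reflections.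
Variable R : comNzRingType.

Definition id_functor (C : category) : functor C C :=
  @Functor C C id (fun _ _ f => f) (fun _ => erefl) (fun _ _ _ _ _ => erefl).

Definition Tot_functor : functor (bC R) (fC R).
Proof.
refine (@Functor (bC R) (fC R) (@Tot R) (fun A B f => @Tot_map R A B f) _ _).
- by move=> A; apply: fhomP.
- by move=> A B E g f; apply: fhomP.
Defined.

Lemma id_page_reflective r (C : fC R) : page_reflective r (id_functor (fC R)) C.
Proof.
exists C, (idm C); split.
- move=> X g; exists g; split; first exact: compm1.
  by move=> h <-; exact: compm1.
- by move=> p n x _.
- by move=> p n y yZ; exists y => //; rewrite /= GRing.subrr; case: (Bbnd_submod r.+2 p n C).
Qed.

Lemma Tot_page_reflective r (V : dmodule R) : page_reflective r Tot_functor (periodic V).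
Proof.
exists (detot V), (detot_unit V); split.
- move=> X g; exists (adj_hom g); split.
    by apply: fhomP => n v; exact: adj_hom_unit.
  move=> h hg; apply: bhom_detot_ext => n v.
  by rewrite adj_hom_unit -hg.
- exact: unit_reflects_boundaries.
- exact: unit_cycles_lift.
Qed.

End Reflections.

Lemma bigmax_mem (S : {fset nat}) : S != fset0 -> \max_(s <- S) s \in S.
Proof.
have max_mem (x : nat) (s : seq nat) : x \in s -> \max_(i <- s) i \in s.
  case: s => // y s _ {x}; elim: s y => [|x s IH] y; first by rewrite big_seq1 mem_head.
  rewrite big_cons inE; case: leqP => [_|_]; first by rewrite IH orbT.
  by rewrite eqxx.
by case/fset0Pn => x; exact: max_mem.
Qed.

Theorem proposition7p1p1 (R : comNzRingType) (S : {fset nat}) :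
  let r := \max_(s <- S) s in
  (S != fset0 ->
     ~ exists (K : mor_class (fC R)) (Mnew : model_data (fC R)),
         left_Bousfield_localisation (fC_model R S) K Mnew /\
         forall (A B : fC R) (f : mor A B), weq Mnew f <-> fC_weq r.+1 f) /\
  (0 \in S ->
     ~ exists (K : mor_class (bC R)) (Mnew : model_data (bC R)),
         left_Bousfield_localisation (bC_model R S) K Mnew /\
         forall (A B : bC R) (f : mor A B), weq Mnew f <-> bC_weq r.+1 f).
Proof.
move=> r; split=> [/bigmax_mem rS | S0] [K [N [[N_model _ N_cof] N_weq]]].
  apply: (@cofibrations_and_weqs_incompatible R r _ (id_functor (fC R)) N) => //.
    move=> A B i lift; apply/N_cof => X Y q [q_fib q_weq]; apply: lift => //.
    move=> p n y yZ; have [x xy] := q_fib r rS p n (Cycle yZ).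
    exists (cycle_val x); first exact: cycle_valP.
    by rewrite -[y]/(cycle_val (Cycle yZ)) -xy.
  by move=> V; exact: id_page_reflective.
have rS : r \in S by apply: bigmax_mem; apply/fset0Pn; exists 0.
apply: (@cofibrations_and_weqs_incompatible R r _ (Tot_functor R) N) => //.
  move=> A B i lift; apply/N_cof => X Y q [q_fib q_weq]; apply: lift => //.
  by apply: tot_cycle_surjective; exact: q_fib.
by move=> V; exact: Tot_page_reflective.
Qed.
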